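(* Let $f\colon T_1\to T_2$ be a homomorphism of complex tori, let $g_1=\dim T_1$, and let $h=\dim (\ker f)_0$, where $(\ker f)_0$ is the connected component of $\ker f$ containing $0$. Then there is an isomorphism of groups $$\frac{\ker f}{(\ker f)_0}\cong \mathbb Z_{d_1(f)}\times\cdots\times\mathbb Z_{d_{2(g_1-h)}(f)}.$$ As a consequence, the number of connected components of $\ker f$ is equal to $\delta_{2(g_1-h)}(f)$. Moreover, if $\ker f$ is finite, then $$\deg(f)=\delta_{2g_1}(f)\quad\text{and}\quad e(f)=d_{2g_1}(f),$$ where for the last equality $g_1\ge 1$, so that $d_{2g_1}(f)$ is defined.
   Context: A complex torus of dimension $g$ is a quotient $T=V/L$ of a complex vector space $V$ of dimension $g$ by a lattice $L$ (a discrete subgroup of $V$ of rank $2g$ generating $V$ as a real vector space). A homomorphism $f\colon T_1=V_1/L_1\to T_2=V_2/L_2$ of complex tori (a holomorphic group homomorphism) is induced by a $\mathbb C$-linear map $\rho_a(f)\colon V_1\to V_2$ with $\rho_a(f)(L_1)\subseteq L_2$ (the analytic representation); its restriction $\rho_r(f)\colon L_1\to L_2$ is the rational representation. $[\rho_r(f)]$ denotes the integral matrix of $\rho_r(f)$, of size $2\dim T_2\times 2\dim T_1$, with respect to chosen $\mathbb Z$-bases of $L_1$ and $L_2$. For $k\ge 1$, the $k$-th determinantal divisor $\delta_k(f)$ is the (positive) greatest common divisor of the minors of order $k$ of $[\rho_r(f)]$ if at least one of them is non-zero, and $\delta_k(f)=0$ otherwise (in particular if $[\rho_r(f)]$ has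 no minors of order $k$); also $\delta_0(f):=1$. These do not depend on the choice of bases. If $r$ is the rank of $[\rho_r(f)]$ (one has $r=2(\dim T_1-\dim(\ker f)_0)$), set $d_k(f):=\delta_k(f)/\delta_{k-1}(f)\in\mathbb Z_{>0}$ for $1\le k\le r$. The connected component $(\ker f)_0$ is a subtorus of $T_1$; $\dim$ denotes complex dimension. The degree $\deg(f)$ is the order of $\ker f$ if $\ker f$ is finite, and $0$ otherwise. If $\ker f$ is finite, the exponent $e(f)$ is the smallest $n\in\mathbb Z_{>0}$ such that $nt=0$ for all $t\in\ker f$. $\mathbb Z_d$ denotes the cyclic group $\mathbb Z/d\mathbb Z$; an empty product of groups is the trivial group. *)

(* Defs.v *)
From HB Require Import structures.
From mathcomp Require Import all_boot all_order all_algebra.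
From mathcomp Require Import generic_quotient ring_quotient.
From mathcomp Require Import complex finmap.
From mathcomp Require Import all_classical all_reals all_analysis.

Set Implicit Arguments.
Unset Strict Implicit.
Unset Printing Implicit Defensive.

Import Order.TTheory GRing.Theory Num.Theory.
Local Open Scope classical_set_scope.
Local Open Scope ring_scope.
Local Open Scope complex_scope.
Local Open Scope quotient_scope.

(* A finite-dimensional complex vector space has one Hausdorff vector space
   topology, given by any norm; the norm carried here serves only to name that
   topology and the usual notion of complex differentiability. *)
#[short(type="finNormedModType")]
HB.structure Definition FinNormedModule (K : numDomainType) :=
  {V of NormedModule K V & Vector K V}.

HB.instance Definition _ (K : numFieldType) m n :=
  NormedModule.on 'M[K]_(m, n).

Section Lattice.
Context (R : realType) (V : finNormedModType R[i]).

Definition is_Zbasis (L : {pred V}) (n : nat) (b : 'I_n -> V) : Prop :=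
  (forall i, b i \in L) /\
  forall v, v \in L -> exists! c : 'rV[int]_n, v = \sum_i b i *~ c 0 i.

Definition zcoord (n : nat) (b : 'I_n -> V) (v : V) : 'rV[int]_n :=
  xget 0 [set c : 'rV[int]_n | v = \sum_i b i *~ c 0 i].

(* L, assumed to be a subgroup, is a lattice in the complex subspace W *)
Definition is_lattice (W : {vspace V}) (L : {pred V}) : Prop :=
  [/\ forall l, l \in L -> l \in W,
      forall l, l \in L -> isolated [set` L] l,
      exists b : 'I_(2 * \dim W) -> V, is_Zbasis L b
    & forall w, w \in W -> exists n (l : 'I_n -> V) (c : 'I_n -> R),
        (forall i, l i \in L) /\ w = \sum_i (c i)%:C *: l i].

End Lattice.

Record complexTorus (R : realType) := ComplexTorus {
  tangent : finNormedModType R[i];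
  lattice : zmodClosed tangent;
  latticeP : is_lattice {:tangent}%VS lattice }.

Definition torus (R : realType) (X : complexTorus R) : Type :=
  Quotient.quot (lattice X).

HB.instance Definition _ (R : realType) (X : complexTorus R) :=
  Quotient.on (torus X).
HB.instance Definition _ (R : realType) (X : complexTorus R) :=
  GRing.Zmodule.on (torus X).

(* This is the topology of [quotient_topology], rebuilt because the latter
   carries a choice structure that differs from the one of the quotient group. *)
Section TorusTopology.
Context (R : realType) (X : complexTorus R).

Definition torus_open : set_system (torus X) :=
  @quotient_open (tangent X) (Quotient.quot (lattice X)).

Let torus_openT : torus_open setT.
Proof. exact: (@openT (quotient_topology (Quotient.quot (lattice X)))). Qed.

Let torus_openI : setI_closed torus_open.
Proof. exact: (@openI (quotient_topology (Quotient.quot (lattice X)))). Qed.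

Let torus_open_bigU (I : Type) (f : I -> set (torus X)) :
  (forall i, torus_open (f i)) -> torus_open (\bigcup_i f i).
Proof.
move=> fo.
apply: (@bigcup_open (quotient_topology (Quotient.quot (lattice X)))) => i _.
exact: fo.
Qed.

HB.instance Definition _ :=
  isOpenTopological.Build (torus X) torus_openT torus_openI torus_open_bigU.

End TorusTopology.

Section TorusTheory.
Context (R : realType) (X : complexTorus R).

Definition torus_pi : tangent X -> torus X := \pi_(torus X).

Lemma torus_piD : {morph torus_pi : v w / v + w}.
Proof.
by move=> v w; exact: (raddfD (\pi_(Quotient.quot (lattice X)))).
Qed.

Lemma torus_reprK (x : torus X) : torus_pi (repr x) = x.
Proof. exact: reprK. Qed.

Lemma torus_translate_continuous (a : torus X) : continuous (fun x => x + a).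
Proof.
apply/continuousP => A; rewrite /open/= /torus_open /quotient_open => Ao.
have -> : \pi_(torus X) @^-1` ((fun x => x + a) @^-1` A)
  = (fun v : tangent X => v + repr a) @^-1` (\pi_(torus X) @^-1` A).
  apply/seteqP; split => v /=;
    by rewrite -[in _ + a](torus_reprK a) -/(torus_pi _) -torus_piD.
by apply: open_comp => // v _; apply: cvgD => //; exact: cvg_cst.
Qed.

End TorusTheory.

Section Subtorus.
Context (R : realType) (X : complexTorus R).

Definition torus_dim : nat := \dim {:tangent X}%VS.

Definition is_subtorus (S : set (torus X)) (W : {vspace tangent X}) : Prop :=
  is_lattice W [predI W & lattice X] /\ S = @torus_pi R X @` [set` W].

(* complex dimension of a subtorus; 0 if S is not a subtorus *)
Definition subtorus_dim (S : set (torus X)) : nat :=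
  xget 0%N [set h | exists2 W, is_subtorus S W & h = \dim W].

End Subtorus.

Section Homomorphism.
Context (R : realType) (X Y : complexTorus R).

(* Local sections of the projections tangent X -> torus X are the charts of the
   complex manifold torus X; holomorphy is read in these charts. *)
Definition holomorphic (f : torus X -> torus Y) : Prop :=
  forall v : tangent X, exists F : tangent X -> tangent Y,
    \forall w \near v,
      differentiable F w /\ torus_pi (F w) = f (torus_pi w).

(* the unique linear lift of a holomorphic homomorphism f *)
Definition analytic_rep (f : torus X -> torus Y) : tangent X -> tangent Y :=
  xget (fun=> 0)
    [set F | linear F /\ forall v, torus_pi (F v) = f (torus_pi v)].

Definition rational_mx (f : torus X -> torus Y) (m n : nat)
    (b : 'I_n -> tangent X) (c : 'I_m -> tangent Y) : 'M[int]_(m, n) :=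
  \matrix_(i, j) zcoord c (analytic_rep f (b j)) 0 i.

Context (f : {additive torus X -> torus Y}).

Definition torus_ker : {pred torus X} := [pred x | f x == 0].

Lemma ker_zmod_closed : zmod_closed torus_ker.
Proof.
split=> [|x y]; rewrite !inE ?raddf0// => /eqP fx /eqP fy.
by rewrite raddfB fx fy subrr.
Qed.
HB.instance Definition _ :=
  GRing.isZmodClosed.Build (torus X) torus_ker ker_zmod_closed.

Definition torus_kerT : Type := {x : torus X | x \in torus_ker}.
HB.instance Definition _ := SubChoice.on torus_kerT.
HB.instance Definition _ := [SubChoice_isSubZmodule of torus_kerT by <:].

Definition torus_ker0 : set (torus X) := connected_component [set` torus_ker] 0.

Definition torus_ker0_pred : {pred torus_kerT} :=
  [pred x : torus_kerT | val x \in torus_ker0].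

Lemma ker0_zmod_closed : zmod_closed torus_ker0_pred.
Proof.
have K0 : [set` torus_ker] 0 by rewrite /= rpred0.
split=> [|x y]; first by rewrite !inE; exact: connected_component_refl.
rewrite !inE => Cx Cy.
pose B := (fun z => z - val y) @` torus_ker0.
have B0 : B 0 by exists (val y); rewrite ?subrr.
have BK : B `<=` [set` torus_ker].
  move=> _ [z /connected_component_sub /= zK <-].
  by rewrite rpredB// (valP y).
have cB : connected B.
  apply: connected_continuous_connected; first exact: component_connected.
  by apply: continuous_subspaceT; exact: torus_translate_continuous.
by apply: (connected_component_max B0 BK cB); exists (val x); rewrite ?raddfB.
Qed.
HB.instance Definition _ :=
  GRing.isZmodClosed.Build torus_kerT torus_ker0_pred ker0_zmod_closed.

Definition component_group : zmodType := Quotient.quot torus_ker0_pred.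

Definition hom_degree : nat :=
  if `[< finite_set [set` torus_ker] >]
  then #|` fset_set [set` torus_ker]|%fset else 0%N.

Definition hom_exponent : nat :=
  xget 0%N [set n | [/\ (0 < n)%N, forall x, x \in torus_ker -> x *+ n = 0
    & forall m, (0 < m)%N -> (forall x, x \in torus_ker -> x *+ m = 0) ->
        (n <= m)%N]].

End Homomorphism.

Section DeterminantalDivisors.
Context (m n : nat) (M : 'M[int]_(m, n)).

Definition increasing (k p : nat) (s : {ffun 'I_k -> 'I_p}) : bool :=
  [forall i : 'I_k, forall j : 'I_k, (i < j)%N ==> (s i < s j)%N].

(* gcdn 0 0 = 0, so this is 0 when all minors vanish or there are none; for
   k = 0 the only minor is the determinant 1 of the empty matrix. *)
Definition det_divisor (k : nat) : nat :=
  \big[gcdn/0%N]_(s : {ffun 'I_k -> 'I_m} | increasing s)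
    \big[gcdn/0%N]_(t : {ffun 'I_k -> 'I_n} | increasing t)
      `|\det (mxsub s t M)|%N.

(* the quotient is exact: each minor of order k is an integral combination
   of minors of order k - 1 *)
Definition inv_factor (k : nat) : nat :=
  (det_divisor k %/ det_divisor k.-1)%N.

End DeterminantalDivisors.

Section Zmod.
Context (d : nat).

Definition Zd_pred : {pred int} := dvdz d%:Z.

Lemma Zd_zmod_closed : zmod_closed Zd_pred.
Proof. by split=> [|x y]; [exact: dvdz0 | exact: rpredB]. Qed.
HB.instance Definition _ :=
  GRing.isZmodClosed.Build int Zd_pred Zd_zmod_closed.

Definition Zd : zmodType := Quotient.quot Zd_pred.

End Zmod.

Section DirectProduct.
Context (I : finType) (G : I -> zmodType).

Definition dprodz : Type := {dffun forall i, G i}.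
HB.instance Definition _ := Choice.on dprodz.

Let add (x y : dprodz) : dprodz := [ffun i => x i + y i].
Let opp (x : dprodz) : dprodz := [ffun i => - x i].
Let zero : dprodz := [ffun i => 0].

Let addA : associative add.
Proof. by move=> x y z; apply/ffunP => i; rewrite !ffunE addrA. Qed.
Let addC : commutative add.
Proof. by move=> x y; apply/ffunP => i; rewrite !ffunE addrC. Qed.
Let add0 : left_id zero add.
Proof. by move=> x; apply/ffunP => i; rewrite !ffunE add0r. Qed.
Let addN : left_inverse zero opp add.
Proof. by move=> x; apply/ffunP => i; rewrite !ffunE addNr. Qed.
HB.instance Definition _ := GRing.isZmodule.Build dprodz addA addC add0 addN.

End DirectProduct.

Definition zmod_isog (G H : zmodType) : Prop :=
  exists phi : {additive G -> H}, bijective phi.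

(* Main.v *)
From HB Require Import structures.
Require Import Defs.
From mathcomp Require Import all_boot all_order all_algebra.
From mathcomp Require Import perm intdiv generic_quotient ring_quotient complex finmap.
From mathcomp Require Import all_classical all_reals all_analysis.

(** Let A be the linear lift of f to the tangent spaces, M its integral matrix, and L1,
    L2 the two lattices. The kernel of f is A^-1 (L2) / L1, and the proof follows the
    value of A on representatives.

    The lift exists and is the differential at 0 of any local holomorphic lift
    (local_lift_linear, analytic_repP). In bases of L1 and L2 adapted to A by the Smith
    normal form of M, A multiplies the k-th basis vector by a nonzero integer d_k for k
    below the rank r, and kills the s others (smith_bases). Determinantal divisors are
    invariant under unimodular changes of basis, so the absolute value of d_k is the
    k-th invariant factor of M (det_divisor_unimodular, det_divisor_smith).

    Since L2 is discrete, A is locally constant modulo A (L1) on the kernel of f. Hence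
    the component of 0 is the image of ker A and consists of the elements on which A
    takes a value in A (L1) (torus_ker0_pi, torus_ker0_image). Reading the coordinates
    of the value of A modulo the d_k then gives a homomorphism from the kernel onto the
    product of the groups Z / d_k, whose kernel is the component of 0
    (component_class_eq0, component_class_onto); this is the isomorphism, and counting
    gives the number of components.

    It remains to identify r with 2 (g1 - h). The s basis vectors in ker A form a real
    basis of it and a Z-basis of its intersection with L1; thus the component of 0 is a
    subtorus with tangent space ker A, and s = 2 h because a subtorus determines its
    tangent space (adapted_kernel_size, pi_vspace_sub, double_subtorus_dim). When the
    kernel of f is finite, ker A is zero, the homomorphism above is injective, and the
    degree and exponent are the order and exponent of the product, the latter being
    the last invariant factor. *)

Set Implicit Arguments.
Unset Strict Implicit.
Unset Printing Implicit Defensive.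

Import Order.TTheory GRing.Theory Num.Theory.
Import numFieldNormedType.Exports.
Local Open Scope classical_set_scope.
Local Open Scope ring_scope.
Local Open Scope complex_scope.

(** * Determinantal divisors of integer matrices *)

(** Divisibility is tested on all index maps, not only on increasing ones: this form
    is visibly stable under products and transposition, and it is equivalent to
    dividing the determinantal divisor. *)
Definition minors_dvd (m n : nat) (M : 'M[int]_(m, n)) (k d : nat) : Prop :=
  forall (s : 'I_k -> 'I_m) (t : 'I_k -> 'I_n), (d %| `|\det (mxsub s t M)|)%N.

(** The rows of a product are linear combinations of the rows of the right factor;
    expanding by multilinearity gives the half of the Cauchy-Binet formula in which
    the selections of rows have not yet been grouped by their image. *)
Lemma det_row_choices (m k : nat) (L : 'M[int]_(k, m)) (N : 'M[int]_(m, k)) :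
  \det (L *m N) =
    \sum_(s : {ffun 'I_k -> 'I_m}) (\prod_i L i (s i)) * \det (rowsub s N).
Proof.
rewrite /determinant.
under eq_bigr do under [\prod_(i < k) _]eq_bigr do rewrite mxE.
under eq_bigr do rewrite bigA_distr_bigA /= big_distrr /=.
rewrite exchange_big /=; apply: eq_bigr => s _.
rewrite big_distrr /=; apply: eq_bigr => p _.
rewrite big_split /= mulrCA; congr (_ * (_ * _)).
by apply: eq_bigr => i _; rewrite mxE.
Qed.

Lemma dvdn_det_mulmxl (m k d : nat) (L : 'M[int]_(k, m)) (N : 'M[int]_(m, k)) :
  (forall s : 'I_k -> 'I_m, (d %| `|\det (rowsub s N)|)%N) ->
  (d %| `|\det (L *m N)|)%N.
Proof.
move=> dN; rewrite det_row_choices -[d]/(`|d%:Z|%N) -dvdzE.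
apply: rpred_sum => s _; apply: dvdz_mull.
by rewrite dvdzE /= dN.
Qed.

Lemma minors_dvd_mull (m p n : nat) (L : 'M[int]_(p, m)) (M : 'M[int]_(m, n))
    k d : minors_dvd M k d -> minors_dvd (L *m M) k d.
Proof.
move=> dM s t.
have -> : mxsub s t (L *m M) = rowsub s L *m colsub t M.
  by apply/matrixP => i j; rewrite !mxE; apply: eq_bigr => l _; rewrite !mxE.
apply: dvdn_det_mulmxl => u; have := dM u t.
by congr (_ %| `|\det _|)%N; apply/matrixP => i j; rewrite !mxE.
Qed.

Lemma minors_dvd_tr (m n : nat) (M : 'M[int]_(m, n)) k d :
  minors_dvd M k d -> minors_dvd M^T k d.
Proof.
move=> dM s t; rewrite -det_tr.
have -> : (mxsub s t M^T)^T = mxsub t s M by apply/matrixP => i j; rewrite !mxE.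
exact: dM.
Qed.

Lemma minors_dvd_mulr (m n p : nat) (M : 'M[int]_(m, n)) (Q : 'M[int]_(n, p))
    k d : minors_dvd M k d -> minors_dvd (M *m Q) k d.
Proof.
move=> dM; rewrite -[M *m Q]trmxK trmx_mul.
by apply: minors_dvd_tr; apply: minors_dvd_mull; apply: minors_dvd_tr.
Qed.

Lemma dvdn_biggcd (I : finType) (P : pred I) (F : I -> nat) (d : nat) :
  (forall i, P i -> (d %| F i)%N) -> (d %| \big[gcdn/0%N]_(i | P i) F i)%N.
Proof.
by move=> dF; elim/big_rec: _ => // i x Pi dx; rewrite dvdn_gcd dF.
Qed.

Lemma biggcd_dvdn (I : finType) (P : pred I) (F : I -> nat) (i : I) :
  P i -> (\big[gcdn/0%N]_(j | P j) F j %| F i)%N.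
Proof. by move=> Pi; rewrite (bigD1 i) //= dvdn_gcdl. Qed.

(** Reordering the rows of a minor only changes its sign, so this reduces a minor
    with distinct rows to one with increasing row indices. *)
Lemma sort_indices (k m : nat) (s : 'I_k -> 'I_m) : injective s ->
  exists (p : 'S_k) (t : {ffun 'I_k -> 'I_m}), increasing t /\ t =1 s \o p.
Proof.
move=> s_inj; pose le (i j : 'I_k) := (s i <= s j)%N.
have le_tr : transitive le by move=> j i l; exact: leq_trans.
have le_tot : total le by move=> i j; exact: leq_total.
pose e := sort le (enum 'I_k).
have es : size e = k by rewrite size_sort size_enum_ord.
case: k => [|k] in s s_inj le le_tr le_tot e es *.
  exists 1%g, [ffun i => s i]; split; last by move=> [].
  by apply/forallP => - [].
have nth_inj : injective (fun i : 'I_k.+1 => nth ord0 e i).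
  move=> i j /eqP; rewrite nth_uniq ?es ?ltn_ord ?sort_uniq ?enum_uniq //.
  by move/eqP/val_inj.
pose p := perm nth_inj.
exists p, [ffun i => s (p i)]; split; last by move=> i; rewrite ffunE.
apply/forallP => i; apply/forallP => j; apply/implyP => ij; rewrite !ffunE.
rewrite ltn_neqAle; apply/andP; split.
  by apply: contraL ij => /eqP/val_inj/s_inj/perm_inj ->; rewrite ltnn.
rewrite !permE; have : sorted le e by exact: sort_sorted.
move/(sorted_leq_nth le_tr (fun i => leqnn (s i)) ord0).
by apply; rewrite ?inE ?es ?ltn_ord // ltnW.
Qed.

(** A minor with a repeated row vanishes and the others agree up to sign with
    increasing ones; the reduction is applied to the rows, then, after
    transposition, to the columns. *)
Lemma minors_dvd_increasing (m n : nat) (M : 'M[int]_(m, n)) k d :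
  (forall (s : {ffun 'I_k -> 'I_m}) (t : {ffun 'I_k -> 'I_n}),
     increasing s -> increasing t -> (d %| `|\det (mxsub s t M)|)%N) ->
  minors_dvd M k d.
Proof.
(* T records the index maps allowed for the columns: any map in the first use;
   increasing ones in the second, where transposition has turned the rows already
   sorted into columns. *)
have step m' n' (N : 'M[int]_(m', n')) (T : ('I_k -> 'I_n') -> Prop) :
    (forall (s : {ffun 'I_k -> 'I_m'}) t, increasing s -> T t ->
       (d %| `|\det (mxsub s t N)|)%N) ->
    forall (s : 'I_k -> 'I_m') t, T t -> (d %| `|\det (mxsub s t N)|)%N.
  move=> dN s t Tt; case: (pselect (injective s)) => [s_inj|s_ninj].
    have [p [u [u_inc us]]] := sort_indices s_inj.
    have := dN u t u_inc Tt.
    have -> : mxsub u t N = row_perm p (mxsub s t N).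
      by apply/matrixP => i j; rewrite !mxE us.
    by rewrite row_permE det_mulmx det_perm abszM abszX abszN exp1n mul1n.
  have [i [j [sij ij]]] : exists i j, s i = s j /\ i <> j.
    apply: contrapT => H; apply: s_ninj => i j sij; apply: contrapT => ij.
    by apply: H; exists i, j.
  rewrite (determinant_alternate (i1 := i) (i2 := j)) //; first exact/eqP.
  by move=> l; rewrite !mxE sij.
move=> dM s t.
pose T (t : 'I_k -> 'I_n) := True.
apply: (@step _ _ M T) => // {}s {}t s_inc _.
pose T' (u : 'I_k -> 'I_m) := exists2 u' : {ffun 'I_k -> 'I_m}, increasing u' & u = u'.
rewrite -det_tr.
have -> : (mxsub s t M)^T = mxsub t s M^T by apply/matrixP => i j; rewrite !mxE.
apply: (@step _ _ M^T T') => [{}t _ t_inc [{s_inc}s s_inc ->]|]; last by exists s.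
rewrite -det_tr.
have -> : (mxsub t s M^T)^T = mxsub s t M by apply/matrixP => i j; rewrite !mxE.
exact: dM.
Qed.

Lemma det_divisorP (m n : nat) (M : 'M[int]_(m, n)) k d :
  (d %| det_divisor M k)%N <-> minors_dvd M k d.
Proof.
split=> [dM|dM].
  apply: minors_dvd_increasing => s t s_inc t_inc; apply: dvdn_trans dM _.
  apply: (dvdn_trans (biggcd_dvdn _ s_inc)).
  exact: (biggcd_dvdn (fun t : {ffun _ -> _} => `|\det (mxsub s t M)|%N) t_inc).
by apply: dvdn_biggcd => s _; apply: dvdn_biggcd => t _; apply: dM.
Qed.

(** Multiplication by any integral matrix can only enlarge the determinantal
    divisors, in the sense of divisibility; for an invertible matrix the inverse
    gives the converse. *)
Lemma det_divisor_unimodular (m n : nat) (P : 'M[int]_m) (Q : 'M[int]_n)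
    (M : 'M[int]_(m, n)) k : P \in unitmx -> Q \in unitmx ->
  det_divisor (P *m M *m Q) k = det_divisor M k.
Proof.
move=> Pu Qu; apply/eqP; rewrite eqn_dvd; apply/andP; split; apply/det_divisorP.
  rewrite -[M in minors_dvd M](mulKmx Pu) -[X in _ *m X](mulmxK Qu).
  by apply/minors_dvd_mull/minors_dvd_mulr/det_divisorP.
by apply/minors_dvd_mulr/minors_dvd_mull/det_divisorP.
Qed.

Definition smith_mx (m n : nat) (d : seq int) : 'M[int]_(m, n) :=
  \matrix_(i, j) (d`_i *+ (i == j :> nat)).

Lemma dvdz_nth (d : seq int) (i j : nat) :
  sorted dvdz d -> (i <= j)%N -> (d`_i %| d`_j)%Z.
Proof.
move=> d_sorted ij; have [jd|jd] := ltnP j (size d); last first.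
  by rewrite (nth_default _ jd) dvdz0.
apply: (sorted_leq_nth (@dvdz_trans) (@dvdzz) 0 d_sorted) => //.
by rewrite inE; exact: leq_ltn_trans jd.
Qed.

Lemma increasing_geq (k m : nat) (s : {ffun 'I_k -> 'I_m}) (i : 'I_k) :
  increasing s -> (i <= s i)%N.
Proof.
move=> /forallP s_inc; case: i => i; elim: i => // i IHi ik.
have ik' := ltnW ik; apply: (leq_ltn_trans (IHi ik')).
by have /forallP/(_ (Ordinal ik))/implyP := s_inc (Ordinal ik'); apply => /=.
Qed.

(** The leading minor is the product of the first diagonal entries. It divides every
    other minor, because the i-th of an increasing sequence of rows has index at
    least i, and the entries of that row are multiples of the i-th invariant factor. *)
Lemma det_divisor_smith (m n : nat) (d : seq int) k :
  sorted dvdz d -> (k <= m)%N -> (k <= n)%N ->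
  det_divisor (smith_mx m n d) k = `|(\prod_(i < k) d`_i)%R|%N.
Proof.
move=> d_sorted km kn; apply/eqP; rewrite eqn_dvd; apply/andP; split.
  have /det_divisorP/(_ (widen_ord km) (widen_ord kn)) :=
    dvdnn (det_divisor (smith_mx m n d) k).
  congr (_ %| `|_|)%N.
  have -> : mxsub (widen_ord km) (widen_ord kn) (smith_mx m n d) =
      diag_mx (\row_(i < k) d`_i).
    by apply/matrixP => i j; rewrite !mxE /= -val_eqE.
  by rewrite det_diag; apply: eq_bigr => i _; rewrite mxE.
apply/det_divisorP/minors_dvd_increasing => s t s_inc _.
rewrite -[X in (X %| _)%N]/(`|(`|(\prod_(i < k) d`_i)%R|%N)%:Z|%N) -dvdzE.
apply: rpred_sum => p _; apply: dvdz_mull; rewrite dvdzE /=.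
rewrite -dvdzE; elim/big_rec2: _ => // i x y _ xy; apply: dvdz_mul => //.
rewrite !mxE; case: eqP => _; last by rewrite mulr0n dvdz0.
by rewrite mulr1n; apply: dvdz_nth => //; exact: increasing_geq.
Qed.

Lemma inv_factor_smith (m n : nat) (d : seq int) k :
  sorted dvdz d -> (k < m)%N -> (k < n)%N -> (forall i, (i < k)%N -> d`_i != 0) ->
  inv_factor (smith_mx m n d) k.+1 = `|(d`_k)%R|%N.
Proof.
move=> d_sorted km kn d_neq0; rewrite /inv_factor /= (det_divisor_smith d_sorted km kn).
rewrite (det_divisor_smith d_sorted (ltnW km) (ltnW kn)).
rewrite big_ord_recr /= abszM mulKn // absz_gt0.
by apply/prodf_neq0 => i _; exact: d_neq0.
Qed.

(** * Quotient groups, cyclic groups and cardinals *)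

Lemma quot_isog (G H : zmodType) (S : zmodClosed G) (theta : {additive G -> H}) :
  (forall x, (theta x == 0) = (x \in S)) -> (forall y, exists x, theta x = y) ->
  zmod_isog (Quotient.quot S) H.
Proof.
move=> theta_ker theta_surj; pose phi (q : Quotient.quot S) : H := theta (repr q).
have phi_pi x : phi (\pi_(Quotient.quot S)%qT x) = theta x.
  apply/eqP; rewrite -subr_eq0 -raddfB theta_ker Quotient.idealrBE.
  by rewrite reprK.
have phi_add : zmod_morphism phi.
  move=> x y; rewrite -{1}[x]reprK -{1}[y]reprK.
  by rewrite -[X in phi X](raddfB (\pi_(Quotient.quot S)%qT)) phi_pi raddfB.
pose phiA := GRing.isZmodMorphism.Build _ _ phi phi_add.
exists (HB.pack phi phiA : {additive _ -> _}) => /=.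
pose psi y := \pi_(Quotient.quot S)%qT (projT1 (cid (theta_surj y))).
exists psi => [q|y]; rewrite /psi; case: cid => x /= thx; last first.
  by rewrite phi_pi.
rewrite -[RHS]reprK; apply/eqP.
by rewrite -Quotient.idealrBE -theta_ker raddfB thx subrr.
Qed.

Lemma card_eq_bij (T U : Type) (A : set T) (B : set U) (f : T -> U) :
  {in A &, injective f} -> f @` A = B -> (A #= B)%card.
Proof. by move=> f_inj <-; rewrite card_eq_sym; exact: inj_card_eq. Qed.

(** Both ranges are the quotient of the source by the same equivalence relation. *)
Lemma card_fibers (T U W : Type) (g : T -> U) (h : T -> W) :
  (forall x y, g x = g y <-> h x = h y) -> (range g #= range h)%card.
Proof.
move=> gh; have [[x0 _]|T0] := pselect ([set: T] !=set0); last first.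
  have rg S (k : T -> S) : range k = set0.
    by apply/seteqP; split=> // y [x]; case: T0; exists x.
  by rewrite !rg.
pose phi u := if pselect (exists x, g x = u) is left e then h (projT1 (cid e))
  else h x0.
have phiE x : phi (g x) = h x.
  rewrite /phi; case: pselect => [e|[]]; last by exists x.
  by apply/gh; exact: (projT2 (cid e)).
apply: (@card_eq_bij _ _ _ _ phi) => [u v|].
  by move=> /set_mem[x _ <-] /set_mem[y _ <-]; rewrite !phiE => /gh.
by rewrite image_comp; apply/seteqP; split=> _ [x _ <-]; exists x => //=.
Qed.

Lemma card_finType (F : finType) : ([set: F] #= `I_#|F|)%card.
Proof.
apply: (@card_eq_bij _ _ _ _ (fun x : F => enum_rank x : nat)).
  by move=> x y _ _ /val_inj/enum_rank_inj.
apply/seteqP; split=> [_ [x _ <-]|i iF] /=; first exact: ltn_ord.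
by exists (enum_val (Ordinal iF)) => //; rewrite enum_valK.
Qed.

Section ZdTheory.
Variable d : nat.

Definition Zd_pi (z : int) : Zd d := \pi_(Quotient.quot (@Zd_pred d))%qT z.

Lemma Zd_piB : {morph Zd_pi : x y / x - y}.
Proof. by move=> x y; exact: (raddfB (\pi_(Quotient.quot (@Zd_pred d))%qT)). Qed.

Lemma Zd_pi_eq (x y : int) : (Zd_pi x == Zd_pi y) = (d%:Z %| x - y)%Z.
Proof. by rewrite -Quotient.idealrBE. Qed.

Lemma Zd_pi_eq0 (x : int) : (Zd_pi x == 0) = (d%:Z %| x)%Z.
Proof.
have -> : (0 : Zd d) = Zd_pi 0 
  by exact/esym/(raddf0 (\pi_(Quotient.quot (@Zd_pred d))%qT)).
by rewrite Zd_pi_eq subr0.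
Qed.

Lemma Zd_reprK (x : Zd d) : Zd_pi (repr x) = x.
Proof. exact: reprK. Qed.

Lemma Zd_piMn (x : int) (n : nat) : Zd_pi x *+ n = Zd_pi (x *+ n).
Proof. exact/esym/(raddfMn (\pi_(Quotient.quot (@Zd_pred d))%qT)). Qed.

End ZdTheory.

Lemma card_dprodz_Zd (n : nat) (d : 'I_n -> nat) : (forall k, 0 < d k)%N ->
  ([set: dprodz (fun k => Zd (d k))] #= `I_(\prod_k d k))%card.
Proof.
move=> d_gt0; pose F := {dffun forall k : 'I_n, 'I_(d k)}.
have -> : (\prod_k d k = #|F|)%N.
  rewrite card_dep_ffun foldrE big_map big_enum /=.
  by apply: eq_bigr => k _; rewrite card_ord.
apply: card_eq_trans (card_finType F); rewrite card_eq_sym.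
pose cls (x : F) : dprodz (fun k => Zd (d k)) := [ffun k => Zd_pi (d k) (x k : nat)%:Z].
apply: (@card_eq_bij _ _ _ _ cls) => [x y _ _ /ffunP xy|].
  apply/ffunP => k; apply/val_inj; have /eqP := xy k; rewrite !ffunE Zd_pi_eq.
  rewrite -eqz_mod_dvd !modz_small ?lez_nat ?ltz_nat ?ltn_ord //.
  by move=> /eqP[].
apply/seteqP; split=> // x _.
have rk k : (`|(repr (x k) %% (d k)%:Z)%Z|%N < d k)%N.
  have dk : (d k)%:Z != 0 :> int by rewrite -lt0n d_gt0.
  by rewrite -ltz_nat gez0_abs ?modz_ge0 // ltz_mod.
exists [ffun k => Ordinal (rk k)] => //; apply/ffunP => k; rewrite !ffunE /=.
rewrite -[RHS]Zd_reprK; apply/eqP; rewrite Zd_pi_eq gez0_abs ?modz_ge0 //; last first.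
  by rewrite -lt0n d_gt0.
by rewrite -eqz_mod_dvd modz_mod.
Qed.

Lemma dprodzMn (I : finType) (G : I -> zmodType) (g : dprodz G) (n : nat) (i : I) :
  (g *+ n) i = g i *+ n.
Proof. by elim: n => [|n IHn]; rewrite ?ffunE // !mulrS ffunE IHn. Qed.

(** * Real coordinates and integral bases *)

Section RealCoordinates.
Variables (R : realType) (V : vectType R[i]).
Implicit Types (W : {vspace V}) (v w : V).

Definition real_comb p (e : 'I_p -> V) (x : 'I_p -> R) : V :=
  \sum_i (x i)%:C *: e i.

Definition real_independent p (e : 'I_p -> V) : Prop :=
  forall x, real_comb e x = 0 -> forall i, x i = 0.

Definition real_spanning W p (e : 'I_p -> V) : Prop :=
  forall w, w \in W -> exists x, w = real_comb e x.

(** The isomorphism of W with a real vector space of dimension 2 dim W, given by the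
    real and imaginary parts of the coordinates in a complex basis. It is what lets
    real ranks be computed by matrices over R. *)
Definition real_coord W v : 'rV[R]_(\dim W + \dim W) :=
  row_mx (\row_k complex.Re (coord (vbasis W) k v))
         (\row_k complex.Im (coord (vbasis W) k v)).

Lemma real_coord_comb W p (e : 'I_p -> V) (x : 'I_p -> R) :
  real_coord W (real_comb e x) = \row_i x i *m \matrix_i real_coord W (e i).
Proof.
apply/rowP => k; rewrite -(fintype.splitK k).
case: (fintype.split k) => j /=; rewrite [RHS]mxE.
  rewrite row_mxEl mxE linear_sum raddf_sum; apply: eq_bigr => i _.
  rewrite mxE mxE row_mxEl mxE linearZ /=.
  by case: (coord _ _ _) => a b; rewrite /= mul0r subr0.
rewrite row_mxEr mxE linear_sum raddf_sum; apply: eq_bigr => i _.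
rewrite mxE mxE row_mxEr mxE linearZ /=.
by case: (coord _ _ _) => a b; rewrite /= mul0r addr0.
Qed.

Lemma real_coord_eq0 W w : w \in W -> real_coord W w = 0 -> w = 0.
Proof.
move=> wW w0; rewrite (coord_vbasis wW) big1 // => k _.
suff -> : coord (vbasis W) k w = 0 by rewrite scale0r.
apply/eqP; rewrite eq_complex /=; apply/andP; split; apply/eqP.
  by have /rowP/(_ (lshift _ k)) := w0; rewrite row_mxEl !mxE.
by have /rowP/(_ (rshift _ k)) := w0; rewrite row_mxEr !mxE.
Qed.

Lemma real_coord_onto W (x : 'rV[R]_(\dim W + \dim W)) :
  exists2 w, w \in W & real_coord W w = x.
Proof.
pose z k := x 0 (lshift _ k) +i* x 0 (rshift _ k).
exists (\sum_k z k *: (vbasis W)`_k).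
  by apply: memv_suml => k _; apply/memvZ/vbasis_mem/mem_nth; rewrite size_tuple.
have zE k : coord (vbasis W) k (\sum_k z k *: (vbasis W)`_k) = z k.
  by rewrite coord_sum_free // (basis_free (vbasisP W)).
apply/rowP => k; rewrite -(fintype.splitK k); case: (fintype.split k) => j /=.
  by rewrite row_mxEl mxE zE.
by rewrite row_mxEr mxE zE.
Qed.

Lemma real_spanning_row_full W p (e : 'I_p -> V) :
  real_spanning W e -> row_full (\matrix_i real_coord W (e i)).
Proof.
move=> e_span; rewrite -sub1mx; apply/row_subP => k.
have [w wW <-] := real_coord_onto (row k 1%:M); have [x ->] := e_span w wW.
by rewrite real_coord_comb submxMl.
Qed.

(** A real generating family of 2 dim W vectors has a square coordinate matrix of
    full rank. *)
Lemma real_spanning_independent W p (e : 'I_p -> V) :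
  p = (2 * \dim W)%N -> real_spanning W e -> real_independent e.
Proof.
move=> pE /real_spanning_row_full; rewrite /row_full => /eqP rk x x0.
have free : row_free (\matrix_i real_coord W (e i)).
  by rewrite /row_free rk pE mul2n addnn.
have : \row_i x i *m \matrix_i real_coord W (e i) = 0.
  rewrite -real_coord_comb x0; apply/rowP => k; rewrite [RHS]mxE -(fintype.splitK k).
  by case: (fintype.split k) => j /=; rewrite (row_mxEl, row_mxEr) mxE linear0.
move/eqP; rewrite mulmx_free_eq0 // => /eqP/rowP xE i.
by have := xE i; rewrite !mxE.
Qed.

(** The coordinate matrix has full column rank since the family spans and full row
    rank since it is independent, so it is square. *)
Lemma real_basis_size W p (e : 'I_p -> V) : (forall i, e i \in W) ->
  real_spanning W e -> real_independent e -> p = (2 * \dim W)%N.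
Proof.
move=> eW /real_spanning_row_full; rewrite /row_full => /eqP rk e_ind.
suff /eqP <- : row_free (\matrix_i real_coord W (e i)) by rewrite rk mul2n addnn.
rewrite -kermx_eq0; apply/rowV0P => c /sub_kermxP c0; apply/rowP => i.
have cE : c = \row_i c 0 i by apply/rowP => j; rewrite mxE.
rewrite [RHS]mxE; apply: (e_ind (c 0)).
apply: (@real_coord_eq0 W); last by rewrite real_coord_comb -cE.
by apply: memv_suml => j _; exact: memvZ.
Qed.

End RealCoordinates.

Section IntegralBases.
Variable V : zmodType.

(** The matrix product of b, seen as a row of vectors, with P: a change of basis when
    P is invertible, and the images of a basis under a homomorphism of matrix P when
    b is the basis of the target. *)
Definition rebase n p (b : 'I_n -> V) (P : 'M[int]_(n, p)) (k : 'I_p) : V :=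
  \sum_i b i *~ P i k.

Lemma rebaseM n p q (b : 'I_n -> V) (P : 'M[int]_(n, p)) (Q : 'M[int]_(p, q)) :
  rebase (rebase b P) Q =1 rebase b (P *m Q).
Proof.
move=> k; rewrite /rebase.
under eq_bigr do rewrite mulrz_suml.
rewrite exchange_big /=; apply: eq_bigr => i _.
by rewrite mxE mulrz_sumr; apply: eq_bigr => j _; rewrite mulrzA.
Qed.

Lemma rebase_comb n p (b : 'I_n -> V) (P : 'M[int]_(n, p)) (c : 'rV[int]_p) :
  \sum_k rebase b P k *~ c 0 k = \sum_i b i *~ (c *m P^T) 0 i.
Proof.
have := rebaseM b P c^T 0; rewrite /rebase.
under [X in X = _ -> _]eq_bigr do rewrite mxE.
move=> ->; apply: eq_bigr => i _.
by rewrite -[P in P *m _]trmxK -trmx_mul mxE.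
Qed.

Lemma rebase_smith m n (b : 'I_m -> V) (d : seq int) (j : 'I_n) :
  rebase b (smith_mx m n d) j =
    if insub (j : nat) is Some i then b i *~ d`_j else 0.
Proof.
rewrite /rebase; case: insubP => [i jm ij|jm].
  rewrite (bigD1 i) //= mxE ij eqxx mulr1n big1 ?addr0 // => k ki.
  rewrite mxE; case: eqP => [kj|_]; last by rewrite mulr0n mulr0z.
  by case/eqP: ki; apply/val_inj; exact: etrans kj (esym ij).
rewrite big1 // => k _; rewrite mxE; case: eqP => [kj|_]; last by rewrite mulr0n mulr0z.
by case/negP: jm; rewrite -kj.
Qed.

End IntegralBases.

Section LatticeBases.
Variables (R : realType) (V : finNormedModType R[i]).
Implicit Types (W : {vspace V}) (L : {pred V}).

Lemma rebase_Zbasis (L : zmodClosed V) n (b : 'I_n -> V) (P : 'M[int]_n) :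
  P \in unitmx -> is_Zbasis L b -> is_Zbasis L (rebase b P).
Proof.
move=> Pu [bL b_coord]; split=> [k|v vL].
  by apply: rpred_sum => i _; apply: rpredMz.
have PTu : P^T \in unitmx by rewrite unitmx_tr.
have [c [vc c_uniq]] := b_coord v vL; exists (c *m invmx P^T); split.
  by rewrite rebase_comb mulmxKV.
move=> c'; rewrite rebase_comb => /c_uniq ->.
by rewrite mulmxK.
Qed.

(** Some lattice vectors span W over R; expanding them in the given Z-basis shows that
    this basis spans as well. *)
Lemma lattice_real_spanning W L n (b : 'I_n -> V) :
  is_lattice W L -> is_Zbasis L b -> real_spanning W b.
Proof.
move=> [_ _ _ L_span] [_ b_coord] w wW; have [k [l [x [lL ->]]]] := L_span w wW.
have lE i : exists c : 'rV[int]_n, l i = \sum_j b j *~ c 0 j.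
  by have [c [lc _]] := b_coord (l i) (lL i); exists c.
exists (fun j => \sum_i x i * (projT1 (cid (lE i)) 0 j)%:~R).
rewrite /real_comb; under [RHS]eq_bigr do rewrite raddf_sum scaler_suml.
rewrite exchange_big /=; apply: eq_bigr => i _.
case: cid => c /= ->; rewrite scaler_sumr; apply: eq_bigr => j _.
by rewrite -scaler_int scalerA rmorphM /= rmorph_int.
Qed.

End LatticeBases.

(** * The analytic representation *)

Section TorusProjection.
Variables (R : realType) (X : complexTorus R).

Lemma torus_piB : {morph @torus_pi R X : v w / v - w}.
Proof. by move=> v w; exact: (raddfB (\pi_(Quotient.quot (lattice X)))%qT). Qed.

Lemma torus_piMn (v : tangent X) n : torus_pi (v *+ n) = torus_pi v *+ n.
Proof. exact: (raddfMn (\pi_(Quotient.quot (lattice X)))%qT). Qed.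

Lemma torus_pi_eq (v w : tangent X) :
  (torus_pi v == torus_pi w) = (v - w \in lattice X).
Proof. by rewrite Quotient.idealrBE. Qed.

Lemma torus_pi_eq0 (v : tangent X) : (torus_pi v == 0) = (v \in lattice X).
Proof.
have -> : (0 : torus X) = torus_pi 0.
  exact/esym/(raddf0 (\pi_(Quotient.quot (lattice X)))%qT).
by rewrite torus_pi_eq subr0.
Qed.

Lemma torus_pi_continuous : continuous (@torus_pi R X).
Proof. by apply/continuousP. Qed.

Lemma torus_pi0 : @torus_pi R X 0 = 0.
Proof. by apply/eqP; rewrite torus_pi_eq0 rpred0. Qed.

Lemma lattice_discrete : exists2 e : R[i], 0 < e &
  forall l, l \in lattice X -> `|l| < e -> l = 0.
Proof.
have [_ L_isol _ _] := latticeP X.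
have [_ [U /nbhs_ballP[e /= e_gt0 eU] UL]] := L_isol 0 (rpred0 _).
exists e => // l lL le; suff : [set (0 : tangent X)] l by [].
by rewrite -UL; split => //; apply: eU; rewrite -ball_normE /= sub0r normrN.
Qed.

End TorusProjection.

Section Dyadic.
Variable R : realType.

(** The scalars live in R[i], whose norm takes real values, so the archimedean property
    of R applies. *)
Lemma halvings_small (V : normedModType R[i]) (v : V) (e : R[i]) : 0 < e ->
  exists n, `|(2 ^- n) *: v| < e.
Proof.
move=> e_gt0.
have : `|v| / e \is Num.real by rewrite realM ?realV ?normr_real ?gtr0_real.
move=> /complex_realP[r rE].
have r_ge0 : 0 <= r by rewrite -lecR -rE divr_ge0 // ltW.
exists (Num.bound r).
rewrite normrZ normfV normrX [ `|2| ]ger0_norm // mulrC ltr_pdivrMr ?exprn_gt0 //.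
rewrite mulrC -ltr_pdivrMr // rE -natrX -(rmorph_nat (real_complex R)) ltcR.
apply: (lt_trans (archi_boundP r_ge0)).
by rewrite ltr_nat ltn_expl.
Qed.

Lemma halvingsK (V : lmodType R[i]) (v : V) n : ((2 ^- n) *: v) *+ (2 ^ n) = v.
Proof.
by rewrite -scaler_nat scalerA natrX divff ?scale1r // expf_neq0 // pnatr_eq0.
Qed.

(** Repeated halving brings v arbitrarily close to 0, where the lattice has no other
    point. This is how discreteness is used against complex subspaces and linear
    maps. *)
Lemma lattice_no_line (X : complexTorus R) (v : tangent X) :
  (forall n, (2 ^- n) *: v \in lattice X) -> v = 0.
Proof.
move=> vL; have [e e_gt0 eL] := lattice_discrete X.
have [n vn] := halvings_small v e_gt0.
by rewrite -[v](halvingsK v n) (eL _ (vL n) vn) mul0rn.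
Qed.

End Dyadic.

Section AnalyticRepresentation.
Variables (R : realType) (X Y : complexTorus R) (f : {additive torus X -> torus Y}).
Hypothesis f_holo : holomorphic f.

(** Let G be the local holomorphic lift of f at 0, normalised by G 0 = 0. As G lifts a
    homomorphism, G w - 2 G (w / 2) lies in the lattice; it is small near 0, hence
    zero. So G w = 2 ^ n G (w / 2 ^ n), and as n grows the right-hand side tends to
    the value at w of the differential of G at 0. The lift is therefore linear near
    0, with linear part its own differential. *)
Lemma local_lift_linear : exists A : {linear tangent X -> tangent Y},
  continuous A /\ exists2 r : R[i], 0 < r &
    forall w, `|w| < r -> torus_pi (A w) = f (torus_pi w).
Proof.
have [F F_lift] := f_holo 0.
have [F_diff F0] := nbhs_singleton F_lift.
have FL : F 0 \in lattice Y.
  rewrite -torus_pi_eq0 F0.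
  have /eqP -> : torus_pi (0 : tangent X) == 0 by rewrite torus_pi_eq0 rpred0.
  by rewrite raddf0.
pose G w := F w - F 0.
have G_lift : \forall w \near (0 : tangent X), torus_pi (G w) = f (torus_pi w).
  near=> w; have [_ <-] : differentiable F w /\ torus_pi (F w) = f (torus_pi w).
    by near: w.
  by apply/eqP; rewrite torus_pi_eq /G addrAC subrr add0r rpredN.
exists ('d F (nbhs 0)); split; first exact: diff_continuous.
have [e e_gt0 eL] := lattice_discrete Y.
(* One third of e is kept for G w and two thirds for the two copies of
   G (w / 2), so that their difference is shorter than e. *)
have e3_gt0 : 0 < e / 3 by rewrite divr_gt0.
have G_small : \forall w \near (0 : tangent X), `|G w| < e / 3.
  have /cvgr_dist_lt/(_ _ e3_gt0) : {for 0, continuous F}.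
    exact: differentiable_continuous.
  by apply: filterS => w; rewrite distrC.
have [r /= r_gt0 rG] : exists2 r : R[i], 0 < r & forall w : tangent X, `|w| < r ->
    torus_pi (G w) = f (torus_pi w) /\ `|G w| < e / 3.
  have /nbhs_ballP[r r_gt0 rG] : nbhs (0 : tangent X) [set w |
      torus_pi (G w) = f (torus_pi w) /\ `|G w| < e / 3].
    exact: filterI G_lift G_small.
  by exists r => // w wr; apply: rG; rewrite -ball_normE /= sub0r normrN.
have half_lt (w : tangent X) n : `|w| < r -> `|(2 ^- n) *: w| < r.
  apply: le_lt_trans; rewrite normrZ normfV normrX [ `|2| ]ger0_norm //.
  by rewrite ler_piMl // invf_le1 ?exprn_gt0 // exprn_ege1 // ler1n.
have G_double w : `|w| < r -> G w = G (2^-1 *: w) *+ 2.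
  move=> wr; have w2r := half_lt w 1%N wr; rewrite expr1 in w2r.
  have [Gw Gw_lt] := rG _ wr; have [Gw2 Gw2_lt] := rG _ w2r.
  apply/eqP; rewrite -subr_eq0; apply/eqP/eL.
    rewrite -torus_pi_eq0 torus_piB torus_piMn Gw Gw2 -raddfMn -torus_piMn.
    by rewrite -{1}(halvingsK w 1) expr1 subrr.
  apply: (le_lt_trans (ler_normB _ _)); rewrite normrMn.
  have -> : e = e / 3 + (e / 3) *+ 2 by rewrite -mulrS -[RHS]mulr_natr divfK // pnatr_eq0.
  by rewrite ltrD // ltrMn2r.
have G_halvings w n : `|w| < r -> G w = G ((2 ^- n) *: w) *+ (2 ^ n).
  move=> wr; elim: n => [|n ->]; first by rewrite expr0 invr1 scale1r.
  rewrite (G_double _ (half_lt w n wr)) scalerA -mulrnA expnS; congr (G (_ *: w) *+ _).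
  by rewrite -invfM -exprS.
exists r => // w wr; suff <- : G w = 'd F (nbhs 0) w by case: (rG w wr).
apply/eqP; rewrite -subr_eq0 -normr_eq0; apply/eqP/le_anti; rewrite normr_ge0 andbT.
have G_o : forall eps : R[i], 0 < eps ->
    \forall h \near (0 : tangent X), `|G h - 'd F (nbhs 0) h| <= eps * `|h|.
  move=> eps eps_gt0; have /eqaddoP/(_ eps eps_gt0) := diff_locally F_diff.
  by apply: filterS => h; rewrite /= !fctE /= addr0 /G opprD addrA.
apply/ler_addgt0Pr => z z_gt0; rewrite add0r.
have w1_gt0 : 0 < `|w| + 1 by rewrite ltr_wpDl.
have /nbhs_ballP[s s_gt0 sG] := G_o (z / (`|w| + 1)) (divr_gt0 z_gt0 w1_gt0).
have [n wn] := halvings_small w s_gt0.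
have := sG ((2 ^- n) *: w); rewrite -ball_normE /= sub0r normrN => /(_ wn).
have -> : G w - 'd F (nbhs 0) w =
    (G ((2 ^- n) *: w) - 'd F (nbhs 0) ((2 ^- n) *: w)) *+ (2 ^ n).
  by rewrite mulrnBl -G_halvings // -(raddfMn ('d F (nbhs 0))) halvingsK.
rewrite normrMn normrZ normfV normrX [ `|2| ]ger0_norm // => le1.
apply: (@le_trans _ _ ((z / (`|w| + 1) * ((2 ^+ n)^-1 * `|w|)) *+ 2 ^ n)).
  by rewrite lerMn2r le1 orbT.
rewrite -mulr_natr natrX mulrAC -!mulrA mulVKf ?expf_neq0 ?pnatr_eq0 //.
rewrite ger_pMr // ler_pdivrMl // mulr1.
by rewrite lerDl.
Unshelve. all: by end_near. Qed.

(** A linear lift near 0 is a lift everywhere, because every vector is a multiple of a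
    vector near 0. Two linear lifts differ by a linear map with values in the
    lattice, which vanishes by discreteness, so the chosen lift is the differential
    and in particular is continuous. *)
Lemma analytic_repP : exists A : {linear tangent X -> tangent Y},
  [/\ analytic_rep f = A, continuous A
    & forall v, torus_pi (A v) = f (torus_pi v)].
Proof.
have [A [A_cont [r r_gt0 A_lift]]] := local_lift_linear.
have A_glob v : torus_pi (A v) = f (torus_pi v).
  have [n vn] := halvings_small v r_gt0.
  rewrite -(halvingsK v n) raddfMn !torus_piMn raddfMn; congr (_ *+ _).
  exact: A_lift.
exists A; split=> //.
rewrite /analytic_rep; case: xgetP => [B _ [B_lin B_lift]|/(_ A)[]]; last first.
  by split=> //; exact: linearP.
apply/funext => v; apply/eqP; rewrite -subr_eq0; apply/eqP/lattice_no_line => n.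
pose BL := GRing.isLinear.Build _ _ _ _ B B_lin.
pose B' : {linear tangent X -> tangent Y} := HB.pack B BL.
have -> : 2 ^- n *: (B v - A v) = B' (2 ^- n *: v) - A (2 ^- n *: v).
  by rewrite scalerBr (linearZ_LR B') (linearZ_LR A).
by rewrite -torus_pi_eq B_lift A_glob.
Qed.

End AnalyticRepresentation.

(** * Bases adapted to a linear map between lattices *)

Lemma zcoordP (R : realType) (V : finNormedModType R[i]) (L : {pred V}) n
    (b : 'I_n -> V) (v : V) :
  is_Zbasis L b -> v \in L -> v = \sum_i b i *~ zcoord b v 0 i.
Proof.
move=> [_ b_coord] vL; have [c [vc _]] := b_coord v vL.
by rewrite /zcoord; case: xgetP => [c' _ //|/(_ c)].
Qed.

Lemma Zbasis_inj (R : realType) (V : finNormedModType R[i]) (L : zmodClosed V) n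
    (b : 'I_n -> V) (y z : 'I_n -> int) :
  is_Zbasis L b -> \sum_i b i *~ y i = \sum_i b i *~ z i -> y =1 z.
Proof.
move=> [bL b_coord] yz i.
have [|c [_ c_uniq]] := b_coord (\sum_i b i *~ y i).
  by apply: rpred_sum => j _; apply: rpredMz.
have := c_uniq (\row_j y j); have := c_uniq (\row_j z j).
have E (x : 'I_n -> int) : \sum_j b j *~ x j = \sum_j b j *~ (\row_j x j) 0 j.
  by apply: eq_bigr => j _; rewrite mxE.
rewrite -!E => /(_ yz) -> /(_ erefl) /rowP/(_ i).
by rewrite !mxE.
Qed.

Lemma rational_mx_rebase (R : realType) (X Y : complexTorus R)
    (f : torus X -> torus Y) (m n : nat)
    (b : 'I_n -> tangent X) (c : 'I_m -> tangent Y) (j : 'I_n) :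
  is_Zbasis (lattice Y) c -> analytic_rep f (b j) \in lattice Y ->
  analytic_rep f (b j) = rebase c (rational_mx f b c) j.
Proof.
move=> c_basis Ab; rewrite {1}(zcoordP c_basis Ab) /rebase.
by apply: eq_bigr => i _; rewrite mxE.
Qed.

(** Writing the matrix of A in Smith normal form P D Q, the bases c P and b Q^-1 are
    adapted to A: its matrix becomes D. The number r of nonzero invariant factors is
    the rank, and the indices are split at r so that the last s vectors of b' lie in
    the kernel. *)
Lemma smith_bases (R : realType) (V1 V2 : finNormedModType R[i])
    (L1 : zmodClosed V1) (L2 : zmodClosed V2) (A : {linear V1 -> V2})
    n m (b : 'I_n -> V1) (c : 'I_m -> V2) (M : 'M[int]_(m, n)) :
  is_Zbasis L1 b -> is_Zbasis L2 c -> (forall j, A (b j) = rebase c M j) ->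
  exists r s t (b' : 'I_(r + s) -> V1) (c' : 'I_(r + t) -> V2) (d : 'I_r -> int),
    [/\ n = (r + s)%N, m = (r + t)%N, is_Zbasis L1 b', is_Zbasis L2 c' &
    [/\ forall k, A (b' (lshift s k)) = c' (lshift t k) *~ d k,
      forall k, A (b' (rshift r k)) = 0,
      forall k, d k != 0 /\ `|d k|%N = inv_factor M k.+1,
      det_divisor M r = (\prod_k `|d k|)%N
    & forall k l : 'I_r, (k <= l)%N -> (d k %| d l)%Z]].
Proof.
move=> bL cL AM.
have [P Pu [Q Qu [d d_sorted MPQ]]] := int_Smith_normal_form M.
rewrite -/(smith_mx m n d) in MPQ.
pose b1 := rebase b (invmx Q); pose c1 := rebase c P.
have b1L : is_Zbasis L1 b1 by apply: rebase_Zbasis; rewrite ?unitmx_inv.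
have c1L : is_Zbasis L2 c1 by apply: rebase_Zbasis.
have Ab1 j : A (b1 j) = rebase c1 (smith_mx m n d) j.
  rewrite rebaseM -[P *m _](mulmxK Qu) -MPQ -rebaseM /b1 /rebase raddf_sum.
  by apply: eq_bigr => i _; rewrite raddfMz /= AM.
have dM k : det_divisor M k = det_divisor (smith_mx m n d) k.
  by rewrite MPQ det_divisor_unimodular.
have qM k : inv_factor M k = inv_factor (smith_mx m n d) k.
  by rewrite /inv_factor !dM.
(* The divisibility chain puts the zero invariant factors last, so r counts the
   nonzero ones. *)
pose r := find (fun i => d`_i == 0) (iota 0 (minn m n)).
have r_min : (r <= minn m n)%N by rewrite -[X in (_ <= X)%N](size_iota 0) find_size.
have rm : (r <= m)%N := leq_trans r_min (geq_minl _ _).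
have rn : (r <= n)%N := leq_trans r_min (geq_minr _ _).
have d_neq0 i : (i < r)%N -> d`_i != 0.
  move=> ir; have := before_find 0%N ir; rewrite nth_iota ?add0n; first by move=> ->.
  exact: leq_trans r_min.
have d_eq0 i : (r <= i)%N -> (i < m)%N -> (i < n)%N -> d`_i = 0.
  move=> ri im i_n; have r_lt : (r < minn m n)%N.
    by apply: leq_ltn_trans ri _; rewrite leq_min im.
  have : has (fun i => d`_i == 0) (iota 0 (minn m n)).
    by rewrite has_find size_iota.
  move/(nth_find 0%N); rewrite -/r nth_iota // add0n => /eqP dr.
  by have := dvdz_nth d_sorted ri; rewrite dr dvd0z => /eqP.
have [s nE] : exists s, n = (r + s)%N by exists (n - r)%N; rewrite subnKC.
have [t mE] : exists t, m = (r + t)%N by exists (m - r)%N; rewrite subnKC.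
clearbody r; subst n m.
exists r, s, t, b1, c1, (fun k => d`_k); split=> //; split=> [k|k|k||k l kl].
- rewrite Ab1 rebase_smith; case: insubP => [i _ ik|]; last by rewrite /= ltn_addr.
  by congr (c1 _ *~ _); apply: val_inj.
- rewrite Ab1 rebase_smith; case: insubP => // i im ik.
  by rewrite d_eq0 ?mulr0z //= ?leq_addr ?ltn_add2l.
- split; first exact: d_neq0.
  rewrite qM inv_factor_smith ?ltn_addr //.
  by move=> i ik; apply: d_neq0; exact: ltn_trans ik _.
- rewrite dM det_divisor_smith ?leq_addr //.
  by elim/big_rec2: _ => // i x y _ <-; rewrite abszM.
- exact: dvdz_nth.
Qed.

Section AdaptedBases.
Variables (R : realType) (V1 V2 : finNormedModType R[i]).
Variables (L1 : zmodClosed V1) (L2 : zmodClosed V2) (A : {linear V1 -> V2}).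
Variables (r s t : nat) (b : 'I_(r + s) -> V1) (c : 'I_(r + t) -> V2).
Variable d : 'I_r -> int.
Hypotheses (bL : is_Zbasis L1 b) (cL : is_Zbasis L2 c).
Hypotheses (b_span : real_spanning fullv b) (b_ind : real_independent b).
Hypothesis c_ind : real_independent c.
Hypothesis Ab_l : forall k, A (b (lshift s k)) = c (lshift t k) *~ d k.
Hypothesis Ab_r : forall k, A (b (rshift r k)) = 0.
Hypothesis d_neq0 : forall k, d k != 0.

Lemma adapted_real_comb (x : 'I_(r + s) -> R) :
  A (real_comb b x) = \sum_k (x (lshift s k) * (d k)%:~R)%:C *: c (lshift t k).
Proof.
rewrite /real_comb big_split_ord /= raddfD !raddf_sum /=.
rewrite [X in _ + X]big1 ?addr0 => [|k _]; last first.
  by rewrite linearZ_LR Ab_r scaler0.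
apply: eq_bigr => k _; rewrite linearZ_LR Ab_l -scaler_int scalerA.
by rewrite rmorphM /= rmorph_int.
Qed.

Lemma adapted_Zcomb (y : 'I_(r + s) -> int) :
  A (\sum_i b i *~ y i) = \sum_k c (lshift t k) *~ (d k * y (lshift s k)).
Proof.
rewrite big_split_ord /= raddfD !raddf_sum /=.
rewrite [X in _ + X]big1 ?addr0 => [|k _]; last by rewrite raddfMz /= Ab_r mul0rz.
by apply: eq_bigr => k _; rewrite raddfMz /= Ab_l mulrzA.
Qed.

Lemma adapted_lattice l : l \in L1 -> A l \in L2.
Proof.
move=> /(zcoordP bL) ->; rewrite adapted_Zcomb.
by apply: rpred_sum => k _; apply: rpredMz; case: cL => ->.
Qed.

(** A lattice vector in the image of A has integral coordinates in c; by real
    independence the first r are the products of the d k with the real coordinates of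
    v, and the others vanish. *)
Lemma adapted_zcoord v : A v \in L2 -> exists2 x : 'I_(r + s) -> R,
  v = real_comb b x & forall i, (zcoord c (A v) 0 i)%:~R =
    if fintype.split i is inl k then x (lshift s k) * (d k)%:~R else 0.
Proof.
move=> AvL; have [x vx] := b_span (memvf v); exists x => // i.
pose y (i : 'I_(r + t)) : R :=
  if fintype.split i is inl k then x (lshift s k) * (d k)%:~R else 0.
apply/eqP; rewrite -subr_eq0 -/(y i); apply/eqP.
apply: (c_ind (x := fun i => (zcoord c (A v) 0 i)%:~R - y i)).
rewrite /real_comb; under eq_bigr do rewrite raddfB /= scalerBl.
rewrite sumrB; apply/eqP; rewrite subr_eq0; apply/eqP.
transitivity (A v).
  rewrite [RHS](zcoordP cL AvL); apply: eq_bigr => j _.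
  by rewrite rmorph_int scaler_int.
rewrite vx adapted_real_comb big_split_ord /= [X in _ = _ + X]big1 ?addr0 => [|k _].
  by apply: eq_bigr => k _; rewrite /y (unsplitK (inl k)).
by rewrite /y (unsplitK (inr k)) scale0r.
Qed.

Lemma adapted_zcoord_r v k : A v \in L2 -> zcoord c (A v) 0 (rshift r k) = 0.
Proof.
move=> /adapted_zcoord[x _ /(_ (rshift r k))]; rewrite (unsplitK (inr k)).
by move/eqP; rewrite intr_eq0 => /eqP.
Qed.

Lemma adapted_zcoord_lattice l k : l \in L1 ->
  (d k %| zcoord c (A l) 0%R (lshift t k))%Z.
Proof.
move=> lL; have lE := zcoordP bL lL.
have Al : A l \in L2 by exact: adapted_lattice.
pose y (i : 'I_(r + t)) :=
  if fintype.split i is inl k then d k * zcoord b l 0 (lshift s k) else 0.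
have /(Zbasis_inj cL)/(_ (lshift t k)) :
    \sum_i c i *~ zcoord c (A l) 0 i = \sum_i c i *~ y i.
  rewrite -(zcoordP cL Al) {1}lE adapted_Zcomb big_split_ord /=.
  rewrite [X in _ = _ + X]big1 ?addr0 => [|j _].
    by apply: eq_bigr => j _; rewrite /y (unsplitK (inl j)).
  by rewrite /y (unsplitK (inr j)) mulr0z.
by move=> ->; rewrite /y (unsplitK (inl k)) dvdz_mulr.
Qed.

(** The elementary divisors measure how far a lattice vector in the image of A is from
    being the image of a lattice vector. *)
Lemma adapted_image_lattice v : A v \in L2 ->
  (forall k, (d k %| zcoord c (A v) 0%R (lshift t k))%Z) <->
  exists2 l, l \in L1 & A v = A l.
Proof.
move=> AvL; split=> [dv|[l lL ->] k]; last exact: adapted_zcoord_lattice.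
pose y (i : 'I_(r + s)) :=
  if fintype.split i is inl k then (zcoord c (A v) 0%R (lshift t k) %/ d k)%Z else 0.
exists (\sum_i b i *~ y i).
  by apply: rpred_sum => i _; apply: rpredMz; case: bL => ->.
rewrite adapted_Zcomb {1}(zcoordP cL AvL) big_split_ord /=.
rewrite [X in _ + X = _]big1 ?addr0 => [|k _]; last by rewrite adapted_zcoord_r.
by apply: eq_bigr => k _; rewrite /y (unsplitK (inl k)) mulrC divzK.
Qed.

Lemma adapted_zcoordB v w : A v \in L2 -> A w \in L2 ->
  zcoord c (A (v - w)) = zcoord c (A v) - zcoord c (A w).
Proof.
move=> AvL AwL; have AvwL : A (v - w) \in L2 by rewrite raddfB rpredB.
apply/rowP; apply: (Zbasis_inj cL).
rewrite -(zcoordP cL AvwL) raddfB /= {1}(zcoordP cL AvL) {1}(zcoordP cL AwL) -sumrB.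
by apply: eq_bigr => i _; rewrite !mxE mulrzBr.
Qed.

(** The vector with coordinates z k / d k works. *)
Lemma adapted_onto (z : 'I_r -> int) :
  exists2 v, A v \in L2 & forall k, zcoord c (A v) 0 (lshift t k) = z k.
Proof.
pose x (i : 'I_(r + s)) : R :=
  if fintype.split i is inl k then (z k)%:~R / (d k)%:~R else 0.
pose y (i : 'I_(r + t)) :=
  if fintype.split i is inl k then z k else 0.
have AvE : A (real_comb b x) = \sum_i c i *~ y i.
  rewrite adapted_real_comb big_split_ord /= [X in _ = _ + X]big1 ?addr0 => [|k _].
    apply: eq_bigr => k _; rewrite /x /y !(unsplitK (inl k)) divfK ?intr_eq0 //.
    by rewrite rmorph_int scaler_int.
  by rewrite /y (unsplitK (inr k)) mulr0z.
have AvL : A (real_comb b x) \in L2.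
  by rewrite AvE; apply: rpred_sum => i _; apply: rpredMz; case: cL => ->.
exists (real_comb b x) => // k.
have := AvE; rewrite {1}(zcoordP cL AvL) => /(Zbasis_inj cL) ->.
by rewrite /y (unsplitK (inl k)).
Qed.

Let kernel_basis (k : 'I_s) : V1 := b (rshift r k).

Let kernel_basis_in k : kernel_basis k \in lker (linfun A).
Proof. by rewrite memv_ker lfunE /= /kernel_basis Ab_r. Qed.

Let kernel_coord v (x : 'I_(r + s) -> R) : v \in lker (linfun A) ->
  v = real_comb b x -> forall k, x (lshift s k) = 0.
Proof.
rewrite memv_ker lfunE /= => /eqP Av0 vx k.
pose y (i : 'I_(r + t)) : R :=
  if fintype.split i is inl k then x (lshift s k) * (d k)%:~R else 0.
have : real_comb c y = 0.
  rewrite -Av0 vx adapted_real_comb /real_comb big_split_ord /=.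
  rewrite [X in _ + X = _]big1 ?addr0 => [|j _].
    by apply: eq_bigr => j _; rewrite /y (unsplitK (inl j)).
  by rewrite /y (unsplitK (inr j)) scale0r.
move/c_ind/(_ (lshift t k)); rewrite /y (unsplitK (inl k)) => /eqP.
by rewrite mulf_eq0 intr_eq0 (negPf (d_neq0 k)) orbF => /eqP.
Qed.

Let kernel_spanning : real_spanning (lker (linfun A)) kernel_basis.
Proof.
move=> w wW; have [x wx] := b_span (memvf w); exists (fun k => x (rshift r k)).
rewrite {1}wx /real_comb big_split_ord /= [X in X + _ = _]big1 ?add0r // => k _.
by rewrite (kernel_coord wW wx) scale0r.
Qed.

(** The last s vectors of b form a real basis of the complex subspace ker A, whose real
    dimension is twice its complex dimension. *)
Lemma adapted_kernel_size : s = (2 * \dim (lker (linfun A)))%N.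
Proof.
apply: (real_basis_size kernel_basis_in kernel_spanning) => x x0 k.
pose y (i : 'I_(r + s)) : R :=
  if fintype.split i is inr k then x k else 0.
have /b_ind/(_ (rshift r k)) : real_comb b y = 0.
  rewrite -x0 /real_comb big_split_ord /= [X in X + _ = _]big1 ?add0r => [|j _].
    by apply: eq_bigr => j _; rewrite /y (unsplitK (inr j)).
  by rewrite /y (unsplitK (inl j)) scale0r.
by rewrite /y (unsplitK (inr k)).
Qed.

Lemma adapted_kernel_lattice : (forall l, l \in L1 -> isolated [set` L1] l) ->
  is_lattice (lker (linfun A)) [predI lker (linfun A) & L1].
Proof.
move=> L1_isol; split=> [l|l /andP[lW lL]||w wW].
- by case/andP.
- have [_ [U Ul UL]] := L1_isol l lL; split; first by rewrite inE /= inE /= lW.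
  exists U => //; apply/seteqP; split=> [v [Uv /andP[vW vL]]|_ ->].
    by rewrite -UL; split.
  by split; [exact: nbhs_singleton|rewrite /= inE /= lW].
- rewrite -adapted_kernel_size; exists kernel_basis; split=> [k|v /andP[vW vL]].
    by rewrite inE /= kernel_basis_in; case: bL => ->.
  have vE := zcoordP bL vL.
  have z0 k : zcoord b v 0 (lshift s k) = 0.
    apply/eqP; rewrite -(intr_eq0 R); apply/eqP.
    apply: (kernel_coord (x := fun i => (zcoord b v 0 i)%:~R) vW).
    by rewrite {1}vE; apply: eq_bigr => i _; rewrite rmorph_int scaler_int.
  exists (\row_k zcoord b v 0 (rshift r k)); split.
    rewrite {1}vE big_split_ord /= [X in X + _ = _]big1 ?add0r => [|k _].
      by apply: eq_bigr => k _; rewrite mxE.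
    by rewrite z0 mulr0z.
  move=> y vy; apply/rowP => k; rewrite mxE.
  pose y' (i : 'I_(r + s)) := if fintype.split i is inr k then y 0 k else 0.
  have /(Zbasis_inj bL)/(_ (rshift r k)) :
      \sum_i b i *~ zcoord b v 0 i = \sum_i b i *~ y' i.
    rewrite -vE vy big_split_ord /= [X in _ = X + _]big1 ?add0r => [|j _].
      by apply: eq_bigr => j _; rewrite /y' (unsplitK (inr j)).
    by rewrite /y' (unsplitK (inl j)) mulr0z.
  by rewrite /y' (unsplitK (inr k)).
- have [x wx] := kernel_spanning wW; exists s, kernel_basis, x; split=> // k.
  by rewrite inE /= kernel_basis_in; case: bL => ->.
Qed.

End AdaptedBases.

(** * Topology of the kernel and dimension of subtori *)

Section RealLines.
Variables (R : realType) (V : normedModType R[i]).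

Lemma real_line_continuous (v : V) : continuous (fun x : R => x%:C *: v).
Proof.
move=> x; apply/cvgrPdist_lt => e e_gt0.
have v1_gt0 : 0 < `|v| + 1 by rewrite ltr_wpDl.
have /complex_realP[r eE] : e / (`|v| + 1) \is Num.real.
  by rewrite gtr0_real // divr_gt0.
have r_gt0 : 0 < r by rewrite -ltcR -eE divr_gt0.
near=> y; rewrite -scalerBl -(rmorphB (real_complex R)) /= normrZ.
have -> : `|(x - y)%:C| = `|x - y|%:C by rewrite normc_def /= expr0n addr0 sqrtr_sqr.
rewrite -[e](divfK (lt0r_neq0 v1_gt0)) eE.
apply: (@le_lt_trans _ _ (`|x - y|%:C * (`|v| + 1))).
  by rewrite ler_wpM2l ?lerDl // -[0]/(0%:C) lecR.
rewrite ltr_pM2r // ltcR; near: y; exact: cvgr_dist_lt.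
Unshelve. all: by end_near. Qed.

End RealLines.

Section KernelTopology.
Variables (R : realType) (X Y : complexTorus R) (f : {additive torus X -> torus Y}).
Variable A : {linear tangent X -> tangent Y}.
Hypothesis A_cont : continuous A.
Hypothesis A_lift : forall v, torus_pi (A v) = f (torus_pi v).

Lemma lift_lattice l : l \in lattice X -> A l \in lattice Y.
Proof.
rewrite -!torus_pi_eq0 A_lift => /eqP ->.
by rewrite raddf0.
Qed.

Lemma torus_ker_pi v : (torus_pi v \in torus_ker f) = (A v \in lattice Y).
Proof. by rewrite inE -A_lift torus_pi_eq0. Qed.

(** A union of images of real lines, all of which pass through 0. *)
Lemma pi_kernel_connected :
  connected (@torus_pi R X @` [set` lker (linfun A)]).
Proof.
pose line (w : tangent X) := (fun x : R => torus_pi (x%:C *: w)) @` [set: R].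
have -> : @torus_pi R X @` [set` lker (linfun A)] =
    \bigcup_(w in [set` lker (linfun A)]) line w.
  apply/seteqP; split=> [_ [w wW <-]|_ [w wW [x _ <-]]].
    by exists w => //; exists 1 => //; rewrite rmorph1 scale1r.
  by exists (x%:C *: w) => //; exact: memvZ.
apply: bigcup_connected => [|w _].
  by exists 0 => w _; exists 0 => //; rewrite rmorph0 scale0r torus_pi0.
apply: connected_continuous_connected.
  by apply/connected_intervalP.
apply: continuous_subspaceT => x.
apply: continuous_comp; first exact: real_line_continuous.
exact: torus_pi_continuous.
Qed.

(** As P is stable under the image of the lattice, membership does not depend on the
    representative of x; the preimage in the tangent space is then the preimage by A
    of a union of balls. *)
Lemma near_values_open (P : set (tangent Y)) (e : R[i]) :
  (forall p l, P p -> l \in lattice X -> P (p + A l)) ->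
  open [set x : torus X | exists2 p, P p & `|A (repr x) - p| < e].
Proof.
move=> P_inv; rewrite /open /= /torus_open /quotient_open.
have shiftE p u v : A v - (p + A (v - u)) = A u - p.
  by rewrite -{1}(subrK u v) raddfD /= [p + _]addrC opprD addrACA subrr add0r.
have -> : \pi_(torus X)%qT @^-1`
    [set x : torus X | exists2 p, P p & `|A (repr x) - p| < e]
    = \bigcup_(p in P) (A @^-1` [set y | `|y - p| < e]).
  have reprL (v : tangent X) : repr (torus_pi v) - v \in lattice X.
    by rewrite -torus_pi_eq torus_reprK.
  apply/seteqP; split=> [v [p Pp vp]|v [p Pp vp]] /=.
    exists (p + A (v - repr (torus_pi v))).
      by apply: P_inv => //; rewrite -opprB rpredN reprL.
    by rewrite /= shiftE.
  exists (p + A (repr (torus_pi v) - v)); first by apply: P_inv.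
  by rewrite shiftE.
apply: bigcup_open => p _; apply: open_comp => [v _|]; first exact: A_cont.
have -> : [set y | `|y - p| < e] = ball p e.
  by rewrite -ball_normE; apply/seteqP; split=> y /=; rewrite distrC.
have [e_gt0|e_le0] := boolP (0 < e); first exact: ball_open.
have -> : ball p e = set0; last exact: open0.
apply/seteqP; split=> // y; rewrite -ball_normE /= => py.
by case/negP: e_le0; exact: le_lt_trans py.
Qed.

(** The image of ker A is connected and contains 0, which gives one inclusion. For the
    other, A maps a representative of a kernel element into the discrete lattice of
    Y, so the kernel is the disjoint union of two relatively open parts: the elements
    whose value under A is attained on the lattice of X, and the rest. A connected
    subset containing 0 stays in the first part. *)
Lemma torus_ker0_pi v :
  torus_ker0 f (torus_pi v) <-> exists2 l, l \in lattice X & A v = A l.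
Proof.
split=> [v0|[l lL vl]]; last first.
  have -> : torus_pi v = torus_pi (v - l).
    by apply/eqP; rewrite torus_pi_eq opprB addrC subrK.
  have vlW : v - l \in lker (linfun A) by rewrite memv_ker lfunE /= raddfB /= vl subrr.
  apply: (connected_component_max _ _ pi_kernel_connected); last by exists (v - l).
    by exists 0; rewrite ?torus_pi0 //= mem0v.
  move=> _ [w /= wW <-]; rewrite torus_ker_pi.
  by move: wW; rewrite memv_ker lfunE /= => /eqP ->; rewrite rpred0.
have [e e_gt0 eL] := lattice_discrete Y.
(* P holds the values taken by A on the lattice of X, N the other points of the
   lattice of Y; U thickens them, and by the choice of e each thickening meets
   the kernel in the elements whose value lies exactly in P or N. *)
pose P : set (tangent Y) := [set p | exists2 l, l \in lattice X & p = A l].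
pose N : set (tangent Y) := [set` lattice Y] `\` P.
pose U (S : set (tangent Y)) :=
  [set x : torus X | exists2 p, S p & `|A (repr x) - p| < e].
have PL : P `<=` [set` lattice Y] by move=> _ [l lL ->]; exact: lift_lattice.
have P_inv p l : P p -> l \in lattice X -> P (p + A l).
  by move=> [k kL ->] lL; exists (k + l); [exact: rpredD | rewrite raddfD].
have N_inv p l : N p -> l \in lattice X -> N (p + A l).
  move=> [pL pP] lL; split; first by rewrite /= rpredD // lift_lattice.
  move=> pAP; apply: pP; rewrite -(addrK (A l) p) -raddfN.
  by apply: P_inv => //; rewrite rpredN.
have UE (S : set (tangent Y)) x : S `<=` [set` lattice Y] -> x \in torus_ker f ->
    U S x <-> S (A (repr x)).
  move=> SL xK; split=> [[p Sp xp]|Sx]; last first.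
    by exists (A (repr x)); rewrite ?subrr ?normr0.
  have AxL : A (repr x) \in lattice Y by rewrite -torus_ker_pi torus_reprK.
  suff -> : A (repr x) = p by [].
  by apply/eqP; rewrite -subr_eq0; apply/eqP/eL => //; rewrite rpredB //; exact: SL.
have kerE x : torus_ker0 f x -> x \in torus_ker f by move=> /connected_component_sub.
have NL : N `<=` [set` lattice Y] by move=> p [].
pose B := torus_ker0 f `&` U P.
have BE : B = torus_ker0 f.
  apply: (@component_connected _ [set` torus_ker f] 0).
  - exists 0; split; first by apply: connected_component_refl; rewrite /= rpred0.
    apply/UE => //; first exact: rpred0.
    exists (repr (0 : torus X)) => //.
    by rewrite -torus_pi_eq0 torus_reprK.
  - by exists (U P) => //; exact: near_values_open.
  - exists (~` U N); first by apply: open_closedC; exact: near_values_open.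
    apply/seteqP; split=> [x [x0 /UE xP]|x [x0 xN]]; split=> //.
      by move=> /UE[] //; [exact: kerE|move=> _; apply; apply: xP => //; exact: kerE].
    have xK := kerE _ x0; apply/UE => //.
    apply: contrapT => xP; apply: xN; apply/UE => //.
    by split=> //=; rewrite -torus_ker_pi torus_reprK.
have [_ /UE] : B (torus_pi v) by rewrite BE.
case=> // [|l lL Al]; first exact: kerE.
have vL : v - repr (torus_pi v) \in lattice X by rewrite -torus_pi_eq torus_reprK.
exists (l + (v - repr (torus_pi v))); first exact: rpredD.
by rewrite raddfD raddfB /= -Al addrC subrK.
Qed.

Lemma torus_ker0_image :
  torus_ker0 f = @torus_pi R X @` [set` lker (linfun A)].
Proof.
apply/seteqP; split=> [x|_ [w /= wW <-]].
  rewrite -{1}(torus_reprK x) => /torus_ker0_pi[l lL xl]; exists (repr x - l).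
    by rewrite /= memv_ker lfunE /= raddfB /= xl subrr.
  by rewrite -[RHS]torus_reprK; apply/eqP; rewrite torus_pi_eq addrAC subrr add0r rpredN.
apply/torus_ker0_pi; exists 0; rewrite ?rpred0 ?raddf0 //.
by move: wW; rewrite memv_ker lfunE /= => /eqP.
Qed.

End KernelTopology.

Section Components.
Variables (R : realType) (X Y : complexTorus R) (f : {additive torus X -> torus Y}).

Lemma component_translate (a x y : torus X) : a \in torus_ker f ->
  connected_component [set` torus_ker f] x y ->
  connected_component [set` torus_ker f] (x + a) (y + a).
Proof.
move=> aK [B [Bx BK B_conn] By].
exists ((fun z => z + a) @` B); last by exists y.
split; first by exists x.
  by move=> _ [z /BK /= zK <-]; rewrite rpredD.
apply: connected_continuous_connected => //.
by apply: continuous_subspaceT; exact: torus_translate_continuous.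
Qed.

Lemma component_eq (x y : torus X) : x \in torus_ker f -> y \in torus_ker f ->
  connected_component [set` torus_ker f] x = connected_component [set` torus_ker f] y
  <-> torus_ker0 f (x - y).
Proof.
move=> xK yK; split=> [xy|xy0]; last first.
  apply/esym/same_connected_component.
  by have := component_translate yK xy0; rewrite add0r subrK.
have yx : connected_component [set` torus_ker f] y x.
  by rewrite -xy; exact: connected_component_refl.
have := component_translate (_ : - y \in torus_ker f) yx.
by rewrite subrr rpredN => /(_ yK).
Qed.

End Components.

Section SubtorusDimension.
Variables (R : realType) (X : complexTorus R).

Lemma real_uncountable : ~ countable [set: R].
Proof.
move=> /(sub_countable (subset_card_le (@subsetT _ `[0, 1]))).
move=> /countable_lebesgue_measure0.
by rewrite lebesgue_measure_itv /= lte_fin ltr01 sube0 => /eqP; rewrite eqe oner_eq0.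
Qed.

(** For w in W1 and every real x, the vector x w is the sum of an element of W2 and of a
    lattice vector. The lattice is countable and R is not, so two different values of
    x share the same lattice vector; subtracting, a nonzero multiple of w lies in
    W2. *)
Lemma pi_vspace_sub (W1 W2 : {vspace tangent X}) :
  @torus_pi R X @` [set` W1] `<=` @torus_pi R X @` [set` W2] -> (W1 <= W2)%VS.
Proof.
move=> W12; apply/subvP => w wW1.
have tw (x : R) : exists w', (w' \in W2) && (x%:C *: w - w' \in lattice X).
  have [|w' w'W2 /eqP] := W12 (torus_pi (x%:C *: w)).
    by exists (x%:C *: w) => //; exact: memvZ.
  by rewrite torus_pi_eq -opprB rpredN => lL; exists w'; rewrite w'W2.
pose g x := xchoose (tw x); pose l x := x%:C *: w - g x.
have gW x : g x \in W2 by case/andP: (xchooseP (tw x)).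
have lL x : l x \in lattice X by case/andP: (xchooseP (tw x)).
have [_ _ [b bL] _] := latticeP X.
have [x [y [lxy xy]]] : exists x y, l x = l y /\ x != y.
  apply: contrapT => H; apply: real_uncountable; apply/pcard_injP.
  exists (fun x => choice.pickle (zcoord b (l x))) => x y _ _.
  move=> /(pcan_inj choice.pickleK) lxy.
  apply/eqP; apply: contrapT => /negP xy; apply: H; exists x, y; split=> //.
  by rewrite (zcoordP bL (lL x)) lxy -(zcoordP bL (lL y)).
have : (x - y)%:C *: w \in W2.
  have -> : (x - y)%:C *: w = g x - g y.
    rewrite raddfB /= scalerBl; apply/eqP; rewrite -subr_eq0 opprB [g y - _]addrC addrACA.
    by rewrite [- _ + _]addrC -(opprB (y%:C *: w)) -/(l x) lxy subrr.
  exact: rpredB.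
move=> /(memvZ ((x - y)%:C)^-1); rewrite scalerA mulVf ?scale1r //.
by rewrite fmorph_eq0 subr_eq0.
Qed.

(** The dimension is well defined since a subtorus determines its tangent space. *)
Lemma subtorus_dimE (S : set (torus X)) (W : {vspace tangent X}) :
  is_subtorus S W -> subtorus_dim S = \dim W.
Proof.
move=> SW; rewrite /subtorus_dim; case: xgetP => [h _ [W' [_ SW'] ->]|/(_ (\dim W))].
  have [_ {}SW] := SW; suff -> : W' = W by [].
  by apply/eqP; rewrite eqEsubv !pi_vspace_sub // -SW -SW'.
by case; exists W.
Qed.

End SubtorusDimension.

(** * The component group *)

(** Translation by x permutes K, so the sum of the elements of K equals itself plus
    n x, where n is the cardinal of K. *)
Lemma finite_subgroup_exponent (H : zmodType) (K : zmodClosed H) :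
  finite_set [set` K] -> exists2 n, (0 < n)%N & forall x, x \in K -> x *+ n = 0.
Proof.
move=> K_fin; pose S := fset_set [set` K].
have SE x : (x \in S) = (x \in K) by rewrite in_fset_set // mem_setE.
have S0 : 0 \in S by rewrite SE rpred0.
exists (size S); first by rewrite -has_predT; apply/hasP; exists 0.
move=> x xK; pose e := enum_fset S.
have : \sum_(y <- e) (y + x) = \sum_(y <- e) y.
  rewrite -(big_map (fun y => y + x) xpredT id); apply: perm_big.
  apply: uniq_perm; rewrite ?fset_uniq ?map_inj_uniq ?fset_uniq //; first exact: addIr.
  move=> z; apply/mapP/idP => [[y yS ->]|zS].
    by move: yS; rewrite !SE => yK; exact: rpredD.
  exists (z - x); last by rewrite subrK.
  by move: zS; rewrite !SE => zK; exact: rpredB.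
rewrite big_split /= -[RHS]addr0 => /addrI.
by rewrite big_const_seq count_predT iter_addr_0.
Qed.

Section ComponentGroup.
Variables (R : realType) (X Y : complexTorus R) (f : {additive torus X -> torus Y}).
Variable A : {linear tangent X -> tangent Y}.
Hypothesis A_cont : continuous A.
Hypothesis A_lift : forall v, torus_pi (A v) = f (torus_pi v).
Variables (r s t : nat) (b : 'I_(r + s) -> tangent X) (c : 'I_(r + t) -> tangent Y).
Variables (d : 'I_r -> int) (q : 'I_r -> nat).
Hypotheses (bL : is_Zbasis (lattice X) b) (cL : is_Zbasis (lattice Y) c).
Hypotheses (b_span : real_spanning fullv b) (b_ind : real_independent b).
Hypothesis c_ind : real_independent c.
Hypothesis Ab_l : forall k, A (b (lshift s k)) = c (lshift t k) *~ d k.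
Hypothesis Ab_r : forall k, A (b (rshift r k)) = 0.
Hypothesis d_neq0 : forall k, d k != 0.
Hypothesis dq : forall k, `|d k|%N = q k.

Let G := dprodz (fun k : 'I_r => Zd (q k)).

Definition ker_elt (x : torus X) (xK : x \in torus_ker f) : torus_kerT f :=
  exist (fun x => x \in torus_ker f) x xK.

(** A lattice vector of Y has coordinates in c; those of the image by A of a
    representative of x are defined up to the image of the lattice of X, that is,
    modulo the elementary divisors. *)
Definition component_class (x : torus_kerT f) : G :=
  [ffun k => Zd_pi (q k) (zcoord c (A (repr (val x))) 0 (lshift t k))].

Let ker_repr (x : torus_kerT f) : A (repr (val x)) \in lattice Y.
Proof. by rewrite -(torus_ker_pi A_lift) torus_reprK (valP x). Qed.

Let q_dvd k (z : int) : ((q k)%:Z %| z)%Z = (d k %| z)%Z.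
Proof. by rewrite -dq !dvdzE. Qed.

Let class_repr (x : torus_kerT f) (v : tangent X) k : torus_pi v = val x ->
  component_class x k = Zd_pi (q k) (zcoord c (A v) 0 (lshift t k)).
Proof.
move=> vx; have AvL : A v \in lattice Y.
  by rewrite -(torus_ker_pi A_lift) vx (valP x).
have lL : repr (val x) - v \in lattice X by rewrite -torus_pi_eq torus_reprK vx.
apply/eqP; rewrite ffunE Zd_pi_eq q_dvd.
have := adapted_zcoord_lattice bL cL Ab_l Ab_r k lL.
rewrite (adapted_zcoordB cL (ker_repr x) AvL).
by rewrite !mxE.
Qed.

Let class_additive : zmod_morphism component_class.
Proof.
move=> x y; apply/ffunP => k.
rewrite (@class_repr _ (repr (val x) - repr (val y))); last first.
  by rewrite torus_piB !torus_reprK raddfB.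
by rewrite (adapted_zcoordB cL (ker_repr x) (ker_repr y)) !ffunE !mxE Zd_piB.
Qed.

HB.instance Definition _ :=
  GRing.isZmodMorphism.Build (torus_kerT f) G component_class class_additive.

(** All the coordinates are multiples of the elementary divisors exactly when the value
    of A is attained on the lattice of X, which characterises the component of 0. *)
Lemma component_class_eq0 x : (component_class x == 0) = (x \in torus_ker0_pred (f := f)).
Proof.
apply/idP/idP => [/eqP/ffunP x0|].
  rewrite inE /= -(torus_reprK (val x)).
  apply/(torus_ker0_pi A_cont A_lift).
  apply/(adapted_image_lattice bL cL b_span c_ind Ab_l Ab_r (ker_repr x)) => k.
  by have /eqP := x0 k; rewrite !ffunE Zd_pi_eq0 q_dvd.
rewrite inE /= -{1}(torus_reprK (val x)).
move=> /(torus_ker0_pi A_cont A_lift).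
move=> /(adapted_image_lattice bL cL b_span c_ind Ab_l Ab_r (ker_repr x)) dx.
by apply/eqP/ffunP => k; apply/eqP; rewrite !ffunE Zd_pi_eq0 q_dvd.
Qed.

Lemma component_class_onto (y : G) : exists x, component_class x = y.
Proof.
have [v AvL vy] := adapted_onto cL Ab_l Ab_r d_neq0 (fun k => repr (y k)).
have vK : torus_pi v \in torus_ker f by rewrite (torus_ker_pi A_lift).
exists (ker_elt vK); apply/ffunP => k.
by rewrite (@class_repr _ v) // vy Zd_reprK.
Qed.

Lemma component_group_isog : zmod_isog (component_group f) G.
Proof. exact: quot_isog component_class_eq0 component_class_onto. Qed.

Lemma card_component_group : ([set: G] #= `I_(\prod_k q k))%card.
Proof.
by apply: card_dprodz_Zd => k; rewrite -dq absz_gt0.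
Qed.

Lemma range_component_class : range component_class = [set: G].
Proof.
by apply/seteqP; split=> // y _; have [x xy] := component_class_onto y; exists x.
Qed.

Lemma card_components :
  ([set connected_component [set` torus_ker f] x | x in [set` torus_ker f]]
    #= `I_(\prod_k q k))%card.
Proof.
have -> : [set connected_component [set` torus_ker f] x | x in [set` torus_ker f]]
    = range (fun x : torus_kerT f => connected_component [set` torus_ker f] (val x)).
  apply/seteqP; split=> [_ [x /= xK <-]|_ [x _ <-]].
    by exists (ker_elt xK).
  by exists (val x) => //; exact: (valP x).
apply: card_eq_trans card_component_group; rewrite -range_component_class.
apply: card_fibers => x y; rewrite component_eq; try exact: valP.
have -> : component_class x = component_class y <-> component_class (x - y) == 0.
  by rewrite raddfB subr_eq0; split=> /eqP.
by rewrite component_class_eq0 inE.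
Qed.

(** The last s vectors of b are a Z-basis of the intersection of ker A with the
    lattice. *)
Lemma kernel_subtorus : is_subtorus (torus_ker0 f) (lker (linfun A)).
Proof.
split; last exact: torus_ker0_image.
apply: adapted_kernel_lattice Ab_l Ab_r d_neq0 _ => //.
by case: (latticeP X).
Qed.

Lemma double_subtorus_dim : (2 * subtorus_dim (torus_ker0 f) = s)%N.
Proof.
rewrite (subtorus_dimE kernel_subtorus).
by rewrite -(adapted_kernel_size b_span b_ind c_ind Ab_l Ab_r d_neq0).
Qed.

Section FiniteKernel.
Hypothesis fin_ker : finite_set [set` torus_ker f].

(** If n kills the kernel then every w in ker A is n times w / n, hence a lattice vector;
    a complex subspace contained in a lattice is zero. *)
Lemma finite_kernel_lker0 : lker (linfun A) = 0%VS.
Proof.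
have [n n_gt0 nK] := finite_subgroup_exponent fin_ker.
apply/eqP; rewrite -subv0; apply/subvP => w wW; rewrite memv0; apply/eqP.
have W_lat w' : w' \in lker (linfun A) -> w' \in lattice X.
  move=> w'W; have n_neq0 : n%:R != 0 :> R[i] by rewrite pnatr_eq0 -lt0n.
  rewrite -torus_pi_eq0 -[w'](scalerKV n_neq0) scaler_nat torus_piMn nK //.
  rewrite (torus_ker_pi A_lift) linearZ_LR.
  by move: w'W; rewrite memv_ker lfunE /= => /eqP ->; rewrite scaler0 rpred0.
by apply: lattice_no_line => k; apply/W_lat/memvZ.
Qed.

Lemma finite_kernel_rank : s = 0%N.
Proof.
rewrite (adapted_kernel_size b_span b_ind c_ind Ab_l Ab_r d_neq0).
by rewrite finite_kernel_lker0 dimv0.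
Qed.

Lemma component_class_inj : injective component_class.
Proof.
apply: raddf_inj => x /eqP; rewrite component_class_eq0 inE /=.
rewrite (torus_ker0_image A_cont A_lift) finite_kernel_lker0 => -[w /=].
by rewrite memv0 => /eqP ->; rewrite torus_pi0 => x0; apply: val_inj; exact: esym x0.
Qed.

Lemma hom_degreeE : hom_degree f = (\prod_k q k)%N.
Proof.
rewrite /hom_degree asboolT //; apply: card_fset_set.
apply: card_eq_trans card_component_group; rewrite -range_component_class.
have -> : [set` torus_ker f] = range (val : torus_kerT f -> torus X).
  apply/seteqP; split=> [x /= xK|_ [x _ <-]]; last exact: (valP x).
  by exists (ker_elt xK).
apply: card_fibers => x y; split=> [/val_inj -> //|].
by move=> /component_class_inj ->.
Qed.

Hypothesis d_dvd : forall k l : 'I_r, (k <= l)%N -> (d k %| d l)%Z.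

(** The class map is injective here. The element whose coordinates are all 1 shows that
    the last factor must divide n; conversely every factor divides the last one. *)
Lemma kernel_exponent_dvd (l : 'I_r) n : (forall k : 'I_r, (k <= l)%N) ->
  (forall x, x \in torus_ker f -> x *+ n = 0) <-> (q l %| n)%N.
Proof.
move=> l_max; have nE k : Zd_pi (q k) n%:Z == 0 = (q k %| n)%N.
  by rewrite Zd_pi_eq0 dvdzE.
split=> [nK|qn x xK].
  have [x xE] := component_class_onto [ffun k => Zd_pi (q k) 1].
  have : component_class (x *+ n) = 0.
    suff -> : x *+ n = 0 by rewrite raddf0.
    by apply: val_inj; rewrite raddfMn nK ?raddf0 //; exact: (valP x).
  rewrite raddfMn /= xE => /ffunP/(_ l)/eqP.
  by rewrite dprodzMn !ffunE Zd_piMn -nE natz.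
pose x' := ker_elt xK.
suff /(congr1 val) : x' *+ n = 0 by rewrite raddfMn raddf0.
apply: component_class_inj; rewrite raddf0 raddfMn /=; apply/ffunP => k.
rewrite dprodzMn ![in LHS]ffunE Zd_piMn ffunE; apply/eqP; rewrite Zd_pi_eq0.
rewrite -mulr_natr dvdz_mull // natz q_dvd.
have := d_dvd (l_max k); rewrite !dvdzE /= => /dvdn_trans; apply.
by rewrite dq.
Qed.

Lemma hom_exponentE (l : 'I_r) : (forall k : 'I_r, (k <= l)%N) ->
  hom_exponent f = q l.
Proof.
move=> l_max; have ql_gt0 : (0 < q l)%N by rewrite -dq absz_gt0.
have kill n := kernel_exponent_dvd n l_max.
rewrite /hom_exponent; case: xgetP => [n _ [n_gt0 /kill nK n_min]|/(_ (q l))[]].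
  apply/eqP; rewrite eqn_leq; apply/andP; split; last exact: dvdn_leq.
  by apply: n_min => //; apply/kill.
split=> // [|m m_gt0 /kill]; first exact/kill.
exact: dvdn_leq.
Qed.

End FiniteKernel.

End ComponentGroup.

Theorem mainTheorem1 (R : realType) (X Y : complexTorus R)
    (f : {additive torus X -> torus Y}) (f_holo : holomorphic f)
    (b : 'I_(2 * torus_dim X) -> tangent X) (b_basis : is_Zbasis (lattice X) b)
    (c : 'I_(2 * torus_dim Y) -> tangent Y) (c_basis : is_Zbasis (lattice Y) c) :
  let delta := det_divisor (rational_mx f b c) in
  let d := inv_factor (rational_mx f b c) in
  let g1 := torus_dim X in
  let h := subtorus_dim (torus_ker0 f) in
  [/\ zmod_isog (component_group f)
        (dprodz (fun k : 'I_(2 * (g1 - h)) => Zd (d k.+1))),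
      ([set connected_component [set` torus_ker f] x | x in [set` torus_ker f]]
        #= `I_(delta (2 * (g1 - h))%N))%card
    & finite_set [set` torus_ker f] ->
        hom_degree f = delta (2 * g1)%N /\
        ((1 <= g1)%N -> hom_exponent f = d (2 * g1)%N)].
Proof.
move=> delta d g1 h.
have [A [fA A_cont A_lift]] := analytic_repP f_holo.
have AM j : A (b j) = rebase c (rational_mx f b c) j.
  rewrite -fA; apply: rational_mx_rebase => //; rewrite fA.
  by apply: lift_lattice A_lift _ _; case: b_basis => ->.
have [r [s [t [b' [c' [e [nE mE bL cL [Ab_l Ab_r e_d e_delta e_dvd]]]]]]]] :=
  smith_bases b_basis c_basis AM.
have b_span := lattice_real_spanning (latticeP X) bL.
have b_ind : real_independent b' := real_spanning_independent (esym nE) b_span.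
have c_ind : real_independent c'.
  apply: (real_spanning_independent (esym mE)).
  exact: lattice_real_spanning (latticeP Y) cL.
have e_neq0 k : e k != 0 by case: (e_d k).
have e_q k : `|e k|%N = d k.+1 by case: (e_d k).
have h_s : (2 * h = s)%N.
  exact (double_subtorus_dim A_cont A_lift bL b_span b_ind c_ind Ab_l Ab_r e_neq0).
have rE : (2 * (g1 - h) = r)%N by rewrite mulnBr h_s [(2 * g1)%N]nE addnK.
have delta_r : delta r = (\prod_(k < r) d k.+1)%N.
  by rewrite /delta e_delta; apply: eq_bigr => k _; exact: e_q.
rewrite rE delta_r; split.
- exact (component_group_isog (q := fun k : 'I_r => d k.+1) A_cont A_lift bL cL
    b_span c_ind Ab_l Ab_r e_neq0 e_q).
- exact (card_components A_cont A_lift bL cL b_span c_ind Ab_l Ab_r e_neq0 e_q).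
move=> fin_ker.
have s0 := finite_kernel_rank A_lift b_span b_ind c_ind Ab_l Ab_r e_neq0 fin_ker.
have g1E : (2 * g1 = r)%N by rewrite [LHS]nE s0 addn0.
split.
  rewrite g1E delta_r.
  exact (hom_degreeE A_cont A_lift bL cL b_span c_ind Ab_l Ab_r e_neq0 e_q
    fin_ker).
move=> g1_gt0; have r_gt0 : (0 < r)%N by rewrite -g1E muln_gt0.
have r1 : (r.-1 < r)%N by rewrite prednK.
have := hom_exponentE A_cont A_lift bL cL b_span c_ind Ab_l Ab_r e_neq0 e_q
  fin_ker e_dvd (l := Ordinal r1).
rewrite g1E /= prednK //; apply.
by move=> k; rewrite -ltnS prednK.
Qed.
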